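(* Let $p_0$ be the true density of a single observation, let $\pi$ be a prior supported on a set $\mathcal{P}$ of densities, and let $p=p^{(n)}$, $n=1,2,\dots$, be a posterior sequence of random densities for iid data. Let $u\in\{1/2,1/3,1/4,\dots\}$ and $0<t<\infty$, and suppose that for each $n$ the set $\mathcal{P}$ can be covered by a finite number $\overline{N}=\overline{N}(n)$ of $L_1$ balls of radius $n^{-1/u}$. Then, with probability $1$, for all sufficiently large sample sizes $n$, $$d_{-u}^2(p_0,p^{(n)})\le d_t^2(p_0,\pi)+n^{-1}\ln\left[\overline{N}^{1/u}\,n^{2(u^{-1}+t^{-1})}\right],$$ where $$d_t^2(p_0,\pi)\equiv\inf_{K\subset\mathcal{P}}\left[\sup_{q\in K}d_t^2(p_0,q)+n^{-1}\ln\frac{1}{\pi(K)}\right].$$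
   Context: All densities are probability densities of a single observation $Y$ with respect to a common dominating measure. All sets to which $\pi$ is applied are measurable. An $L_1$ ball of radius $r$ is a ball in the set of densities for the distance $\int|f-g|$. Divergence: for $t>-1$, $t\ne0$, and densities $p,q$, $d_t^2(p,q)=t^{-1}\int p\left((p/q)^t-1\right)$, i.e. $1+t\,d_t^2(p,q)=\int p^{1+t}q^{-t}$ (for $t>0$ this is $+\infty$ if $q=0$ on a set of positive $p$-probability; points with $p=0$ contribute $0$). In $d_t^2(p_0,\pi)$, which depends on $n$, sets with $\pi(K)=0$ contribute $+\infty$. Posterior sequence of random densities for iid data: a sequence $p^{(n)}$ (labeled by the sample size $n$) of random density functions in $\mathcal{P}$, defined on one probability space, such that for every $n$ and every subset $A\subset\mathcal{P}$, $$\Pr\left[p^{(n)}\in A\right]=P_0\Pi(A)\equiv\int\left[\frac{\int_{f\in A}\prod_{i=1}^nf(Y_i)\,\pi(df)}{\int_{f\in\mathcal{P}}\prod_{i=1}^nf(Y_i)\,\pi(df)}\right]\prod_{i=1}^np_0(Y_i)\,dY_i ,$$ the ratio being assumed well defined almost surely. That is, for each $n$, $p^{(n)}$ is marginally distributed as a draw from the posterior given $n$ iid observations from $p_0$; nothing is assumed about the joint law across different $n$. *)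

(* Defs.v *)
From HB Require Import structures.
From mathcomp Require Import all_boot all_order all_algebra.
From mathcomp Require Import all_classical all_reals all_analysis.

Set Implicit Arguments.
Unset Strict Implicit.
Unset Printing Implicit Defensive.
Import Order.TTheory GRing.Theory Num.Theory.
Import numFieldNormedType.Exports.
Local Open Scope classical_set_scope.
Local Open Scope ring_scope.

Definition is_density d (Y : measurableType d) (R : realType)
    (mu : {measure set Y -> \bar R}) (f : Y -> R) : Prop :=
  [/\ measurable_fun setT f, forall y, 0 <= f y
    & (\int[mu]_y (f y)%:E = 1)%E].

(* The balls are closed: a cover by open balls is also a cover by closed balls
   of the same radius, so a covering hypothesis is weakest in this form. The
   centre need not belong to the set being covered. *)
Definition L1_ball d (Y : measurableType d) (R : realType)
    (mu : {measure set Y -> \bar R}) (g : Y -> R) (r : R) : set (Y -> R) :=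
  [set f | is_density mu f /\ (\int[mu]_y `|f y - g y|%:E <= r%:E)%E].

Definition L1_covered d (Y : measurableType d) (R : realType)
    (mu : {measure set Y -> \bar R}) (A : set (Y -> R)) (m : nat) (r : R) :
    Prop :=
  exists c : 'I_m -> Y -> R, (forall i, is_density mu (c i)) /\
    A `<=` \bigcup_i L1_ball mu (c i) r.

(* a ((a / b) ^ t - 1) for a, b >= 0, with the limiting values at a = 0 and
   b = 0: at a = 0 it is 0; at a > 0 = b it is +oo if t > 0 and, since
   a (a / b) ^ t = a ^ (1 + t) b ^ (- t) vanishes there, - a if -1 < t < 0.
   The total functions / and `^ do not give these values by themselves. *)
Definition divergence_integrand (R : realType) (t a b : R) : \bar R :=
  if a == 0 then 0%E
  else if b == 0 then (if 0 < t then +oo%E else (- a)%:E)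
  else (a * ((a / b) `^ t - 1))%:E.

(* d_t ^ 2 (p, q), meant for t > -1, t != 0 *)
Definition divergence d (Y : measurableType d) (R : realType)
    (mu : {measure set Y -> \bar R}) (t : R) (p q : Y -> R) : \bar R :=
  (t^-1%:E * \int[mu]_y divergence_integrand t (p y) (q y))%E.

(* d_t ^ 2 (p0, pi) at sample size n. The separate case pi K = 0 matters for
   K = set0, where the supremum is -oo. *)
Definition prior_divergence d (Y : measurableType d) (R : realType)
    (mu : {measure set Y -> \bar R}) (G : set (set (Y -> R)))
    (pi : probability (g_sigma_algebraType G) R) (P : set (Y -> R))
    (t : R) (p0 : Y -> R) (n : nat) : \bar R :=
  ereal_inf [set (if pi K == 0 then +oo
                  else ereal_sup [set divergence mu t p0 q | q in K]
                       + (n%:R^-1)%:E * lne (pi K)^-1)%E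
            | K in [set K : set (g_sigma_algebraType G) |
                     measurable K /\ K `<=` P]].

Definition likelihood (Y : Type) (R : realType) (n : nat) (f : Y -> R)
    (y : n.-tuple Y) : R :=
  \prod_(i < n) f (tnth y i).

Definition marginal d (Y : measurableType d) (R : realType)
    (G : set (set (Y -> R))) (pi : probability (g_sigma_algebraType G) R)
    (n : nat) (A : set (Y -> R)) (y : n.-tuple Y) : \bar R :=
  (\int[pi]_(f in (A : set (g_sigma_algebraType G))) (likelihood f y)%:E)%E.

Definition posterior d (Y : measurableType d) (R : realType)
    (G : set (set (Y -> R))) (pi : probability (g_sigma_algebraType G) R)
    (P : set (Y -> R)) (n : nat) (A : set (Y -> R)) (y : n.-tuple Y) : \bar R :=
  (marginal pi A y / marginal pi P y)%E.

(* int ... int F (y_1, ..., y_n) dy_1 ... dy_n as an iterated integral *)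
Fixpoint nfold_integral d (Y : measurableType d) (R : realType)
    (mu : {measure set Y -> \bar R}) (n : nat) :
    (n.-tuple Y -> \bar R) -> \bar R :=
  match n with
  | 0 => fun F => F [tuple]
  | n'.+1 => fun F =>
      (\int[mu]_y nfold_integral mu (fun ys => F [tuple of y :: ys]))%E
  end.

(* Integral of F against the law of n iid observations with density p0 *)
Definition iid_integral d (Y : measurableType d) (R : realType)
    (mu : {measure set Y -> \bar R}) (p0 : Y -> R) (n : nat)
    (F : n.-tuple Y -> \bar R) : \bar R :=
  nfold_integral mu (fun y => F y * (likelihood p0 y)%:E)%E.

Definition posterior_well_defined d (Y : measurableType d) (R : realType)
    (mu : {measure set Y -> \bar R}) (G : set (set (Y -> R)))
    (pi : probability (g_sigma_algebraType G) R) (P : set (Y -> R))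
    (p0 : Y -> R) (n : nat) : Prop :=
  iid_integral mu p0 (fun y : n.-tuple Y =>
    (\1_[set y | ~ (0 < marginal pi P y < +oo)%E] y)%:E) = 0%E.

(* The value at n = 0 is unconstrained: sample sizes start at 1. *)
Definition posterior_sequence d (Y : measurableType d) (R : realType)
    (mu : {measure set Y -> \bar R}) (G : set (set (Y -> R)))
    (pi : probability (g_sigma_algebraType G) R) (P : set (Y -> R))
    (p0 : Y -> R) dO (Omega : measurableType dO) (Pr : probability Omega R)
    (p : nat -> {RV Pr >-> g_sigma_algebraType G}) : Prop :=
  forall n : nat, (0 < n)%N ->
    [/\ forall w, P (p n w),
        posterior_well_defined mu pi P p0 n
      & forall A : set (g_sigma_algebraType G), measurable A -> A `<=` P ->
          Pr (p n @^-1` A) =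
          iid_integral mu p0 (fun y : n.-tuple Y => posterior pi P A y)].

(* Main.v *)
(* Let A be the set of f with d_{-u}^2(p0, f) above the bound, and L0 the
   likelihood of p0. The posterior mass of A is at most 1, hence at most its own
   u-th power, so it is at most
     1{denominator < delta L0} + (delta L0)^-u (sum over balls B_j of
       (int_(A /\ B_j) prod f(Y_i) pi(df))^u).
   - First term: int (p0/f)^t averaged over K controls the probability that the
     evidence of K is small (a tangent-line form of Jensen and Markov combined);
     delta = pi(K) x0 is chosen to make it n^-2.
   - Second term: integrating one observation at a time replaces the prior weight
     by a reweighted one still supported in A /\ B_j, so each step costs a factor
     int p0^(1-u) m^u with m a mixture of densities of A /\ B_j; as m is within
     the L1 diameter 2 n^(-1/u) of any of them, this factor is at most
     1 - u beta + (2 n^(-1/u))^u <= exp (- u beta + 2/n).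
   The total is O(n^-2), so Borel-Cantelli applies. Since only the support of p0
   matters, mu may be restricted to it, where it is sigma-finite. *)
Require Import Defs.
From HB Require Import structures.
From mathcomp Require Import all_boot all_order all_algebra.
From mathcomp Require Import all_classical all_reals all_analysis.
From mathcomp Require Import measurable_realfun.
From mathcomp Require Import ring lra.

Set Implicit Arguments.
Unset Strict Implicit.
Unset Printing Implicit Defensive.
Import Order.TTheory GRing.Theory Num.Theory.
Import numFieldNormedType.Exports.
Local Open Scope classical_set_scope.
Local Open Scope ring_scope.

(** * Integration *)

Section integral_extra.
Local Open Scope ereal_scope.
Context d (Y : measurableType d) (R : realType).
Implicit Types (mu : {measure set Y -> \bar R}) (f g : Y -> \bar R).
Import HBNNSimple.

(** No measurability is asked: the integral of a nonnegative function is a supremum over the simple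
    functions below it. Hence the posterior ratio can be compared with an upper bound before
    anything is known about its measurability. *)
Lemma ge0_le_integralT mu f g :
  (forall y, 0 <= f y) -> (forall y, f y <= g y) ->
  \int[mu]_y f y <= \int[mu]_y g y.
Proof.
move=> f0 fg; have g0 y : 0 <= g y by exact: le_trans (fg y).
rewrite !ge0_integralTE//; apply: le_ereal_sup => _ [h hf <-].
exists h => // y.
exact: le_trans (hf y) (fg y).
Qed.

Lemma integral_mrestrT mu (D : set Y) (mD : measurable D) f :
  (forall y, ~ D y -> f y = 0) ->
  \int[mrestr mu mD]_y f y = \int[mu]_y f y.
Proof.
move=> fD0; have <- : f \_ D = f.
  by apply/funext => y; rewrite patchE; case: ifPn => // /negP; rewrite inE =>/fD0.
rewrite -!integral_mkcond; apply: eq_measure_integral => A mA AD.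
by rewrite /= /mrestr setIidl.
Qed.

(** [f] may be negative and need not be integrable, but its negative part lies below [g]. It
    therefore has a finite integral, which is added to both sides and cancelled. *)
Lemma integralD_ge0 mu f g :
  measurable_fun setT f -> measurable_fun setT g ->
  (forall y, 0 <= g y) -> (forall y, 0 <= f y + g y) ->
  \int[mu]_y g y < +oo ->
  \int[mu]_y (f y + g y) = \int[mu]_y f y + \int[mu]_y g y.
Proof.
move=> mf mg g0 fg0 ig.
have fNg y : f^\- y <= g y.
  rewrite funenegE ge_max g0 andbT; have := fg0 y.
  case: (f y) => [a| |]; case: (g y) (g0 y) => [b| |] //= _; rewrite ?leey ?leNye //.
  by rewrite -EFinD !lee_fin; lra.
have ifN : \int[mu]_y f^\- y \is a fin_num.
  rewrite ge0_fin_numE ?integral_ge0//.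
  by apply: le_lt_trans ig; exact: ge0_le_integralT.
have : \int[mu]_y (f y + g y) + \int[mu]_y f^\- y = \int[mu]_y f^\+ y + \int[mu]_y g y.
  rewrite -!ge0_integralD//; try by [exact: measurable_funepos|
    exact: measurable_funeneg|exact: emeasurable_funD].
  apply: eq_integral => y _; have := fNg y; have := fg0 y; have := g0 y.
  rewrite funeposE funenegE; case: (f y) => [a| |]; case: (g y) => [b| |] //=.
  + rewrite -!EFin_max -!EFinD !lee_fin => b0 ab0 _; congr EFin.
    rewrite /Num.max; case: ltP => a0; case: ltP => a1; lra.
  + by rewrite -!EFin_max.
  + by rewrite maxNye maxye adde0.
  + by rewrite maxNye maxye adde0.
have iz : 0 <= \int[mu]_y g y by exact: integral_ge0.
have ig' : \int[mu]_y g y \is a fin_num by rewrite ge0_fin_numE.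
move=> e; rewrite (integralE mu setT f) addeAC -e addeK//.
Qed.
End integral_extra.
(** * Iterated integrals *)

Section nfold.
Local Open Scope ereal_scope.
Context d (Y : measurableType d) (R : realType).
Implicit Types mu : {measure set Y -> \bar R}.

Lemma nfold_integral_ge0 mu n (F : n.-tuple Y -> \bar R) :
  (forall ys, 0 <= F ys) -> 0 <= nfold_integral mu F.
Proof.
elim: n F => [|n IH] F F0 /=; first exact: F0.
by apply: integral_ge0 => y _; apply: IH.
Qed.

Lemma le_nfold_integral mu n (F H : n.-tuple Y -> \bar R) :
  (forall ys, 0 <= F ys) -> (forall ys, F ys <= H ys) ->
  nfold_integral mu F <= nfold_integral mu H.
Proof.
elim: n F H => [|n IH] F H F0 FH /=; first exact: FH.
by apply: ge0_le_integralT => y; [exact: nfold_integral_ge0|exact: IH].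
Qed.

Lemma nfold_integral0 mu n :
  nfold_integral mu (fun _ : n.-tuple Y => 0) = 0.
Proof. by elim: n => //= n IH; rewrite integral0_eq. Qed.

Lemma nfold_integral_mrestr mu (D : set Y) (mD : measurable D) n
    (F : n.-tuple Y -> \bar R) :
  (forall ys i, ~ D (tnth ys i) -> F ys = 0) ->
  nfold_integral (mrestr mu mD) F = nfold_integral mu F.
Proof.
elim: n F => [//|n IH] F FD /=.
rewrite -(@integral_mrestrT _ _ _ mu D mD); last first.
  move=> y Dy; rewrite (_ : (fun _ => _) = (fun=> 0)); first exact: nfold_integral0.
  by apply/funext => ys; apply: (FD _ ord0); rewrite tnth0.
apply: eq_integral => y _; apply: IH => ys i Dy.
by apply: (FD _ (lift ord0 i)); rewrite tnthS.
Qed.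

(* Measurability in the sense under which every integral occurring in the
   iterated integral of [F] is the integral of a measurable function. *)
Fixpoint nfold_measurable mu n : (n.-tuple Y -> \bar R) -> Prop :=
  match n with
  | 0 => fun _ => True
  | m.+1 => fun F =>
      (forall y, nfold_measurable mu (fun ys => F [tuple of y :: ys])) /\
      measurable_fun setT (fun y => nfold_integral mu (fun ys => F [tuple of y :: ys]))
  end.

(** Measurability and value are proved together, because measurability of the outer integrand is
    read off from additivity of the inner integrals. *)
Lemma nfold_integralD mu n (F H : n.-tuple Y -> \bar R) :
  (forall ys, 0 <= F ys) -> (forall ys, 0 <= H ys) ->
  nfold_measurable mu F -> nfold_measurable mu H ->
  nfold_measurable mu (fun ys => F ys + H ys) /\
  nfold_integral mu (fun ys => F ys + H ys) =
    nfold_integral mu F + nfold_integral mu H.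
Proof.
elim: n F H => [//|n IH] F H F0 H0 /= [mF1 mF2] [mH1 mH2].
have IHy y := IH _ _ (fun ys => F0 [tuple of y :: ys])
  (fun ys => H0 [tuple of y :: ys]) (mF1 y) (mH1 y).
have e : (fun y => nfold_integral mu (fun ys => F [tuple of y :: ys] + H [tuple of y :: ys]))
    = (fun y => nfold_integral mu (fun ys => F [tuple of y :: ys]) +
        nfold_integral mu (fun ys => H [tuple of y :: ys])).
  by apply/funext => y; exact: (IHy y).2.
rewrite e; split; first by split=> [y|]; [exact: (IHy y).1|exact: emeasurable_funD].
by rewrite ge0_integralD// => y _; exact: nfold_integral_ge0.
Qed.

Lemma nfold_integral_sum mu n (I : Type) (s : seq I)
    (F : I -> n.-tuple Y -> \bar R) :
  (forall i ys, 0 <= F i ys) -> (forall i, nfold_measurable mu (F i)) ->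
  nfold_measurable mu (fun ys => \sum_(i <- s) F i ys) /\
  nfold_integral mu (fun ys => \sum_(i <- s) F i ys) =
    \sum_(i <- s) nfold_integral mu (F i).
Proof.
move=> F0 mF; elim: s => [|i s [IH1 IH2]].
  have -> : (fun ys => \sum_(i <- [::]) F i ys) = (fun=> 0).
    by apply/funext => ys; rewrite big_nil.
  split; last by rewrite big_nil; exact: nfold_integral0.
  by elim: n {F F0 mF} => //= n IH; split.
have -> : (fun ys => \sum_(j <- i :: s) F j ys) = (fun ys => F i ys + \sum_(j <- s) F j ys).
  by apply/funext => ys; rewrite big_cons.
rewrite big_cons -IH2; apply: nfold_integralD => // ys.
by apply: sume_ge0.
Qed.

End nfold.

(** * Iterated integrals of powers of mixtures *)

Section mixture.
Local Open Scope ereal_scope.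
Context dX (X : measurableType dX) d (Y : measurableType d) (R : realType).
Variables (pi : {sigma_finite_measure set X -> \bar R})
  (mu : {sigma_finite_measure set Y -> \bar R}).
Variables (h : X -> Y -> \bar R) (w : Y -> \bar R) (r : R).
Hypotheses (mh : measurable_fun setT (fun z : X * Y => h z.1 z.2))
  (h0 : forall x y, 0 <= h x y).
Hypotheses (mw : measurable_fun setT w) (w0 : forall y, 0 <= w y).

(* Both terms of the bound on the posterior mass have this shape: the evidence of
   K with [h] a tilt of p0, [w = 1] and [r = 1], and the numerator over a ball
   with [h] the evaluation, [w = p0 ^ (1 - u)] and [r = u]. *)
Definition mixture n (c : \bar R) (g : X -> \bar R) (ys : n.-tuple Y) : \bar R :=
  c * (\int[pi]_x (g x * \big[mule/1]_(i < n) h x (tnth ys i))) `^ r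
    * \big[mule/1]_(i < n) w (tnth ys i).

(* Integrating out the first observation moves it into the weights [c] and [g]. *)
Lemma mixture_cons n c g y (ys : n.-tuple Y) :
  mixture c g [tuple of y :: ys] = mixture (c * w y) (fun x => g x * h x y) ys.
Proof.
rewrite /mixture big_ord_recl tnth0.
under eq_bigr do rewrite tnthS.
rewrite !muleA (muleAC c); congr (c * w y * _ `^ r * _).
apply: eq_integral => x _; rewrite big_ord_recl tnth0 muleA.
by under eq_bigr do rewrite tnthS.
Qed.

Lemma mixture_ge0 n c g (ys : n.-tuple Y) : 0 <= c -> 0 <= mixture c g ys.
Proof.
move=> c0; rewrite !mule_ge0 ?poweR_ge0//.
by elim/big_ind: _ => // *; exact: mule_ge0.
Qed.

(** The parameter space [Z] is arbitrary because the induction enlarges it: integrating out an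
    observation [y] produces the weights [c z * w y] and [g z x * h x y], parametrized by [Z * Y],
    and Tonelli gives measurability in [z] of the outer integral. *)
Lemma measurable_nfold_mixture n dZ (Z : measurableType dZ) (c : Z -> \bar R)
    (g : Z -> X -> \bar R) :
  measurable_fun setT c -> (forall z, 0 <= c z) ->
  measurable_fun setT (fun zx : Z * X => g zx.1 zx.2) ->
  (forall z x, 0 <= g z x) ->
  measurable_fun setT (fun z => nfold_integral mu (@mixture n (c z) (g z))).
Proof.
elim: n dZ Z c g => [|n IH] dZ Z c g mc c0 mg g0 /=.
  under eq_fun => z.
    rewrite /mixture big_ord0 mule1; under eq_integral do rewrite big_ord0 mule1.
    over.
  apply: emeasurable_funM => //; apply: (measurableT_comp (measurable_poweR r)).
  exact: (measurable_fun_fubini_tonelli_F (fun zx : Z * X => g zx.1 zx.2)).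
under eq_fun => z.
  under eq_integral do under eq_fun do rewrite mixture_cons.
  over.
pose c' (zy : Z * Y) := c zy.1 * w zy.2.
pose g' (zy : Z * Y) x := g zy.1 x * h x zy.2.
apply: (measurable_fun_fubini_tonelli_F
  (fun zy : Z * Y => nfold_integral mu (@mixture n (c' zy) (g' zy)))); last first.
  by move=> zy; apply: nfold_integral_ge0 => ys; apply: mixture_ge0; exact: mule_ge0.
apply: IH.
- apply: emeasurable_funM; first exact: (measurableT_comp mc).
  exact: (measurableT_comp mw).
- by move=> zy; exact: mule_ge0.
- apply: emeasurable_funM.
    apply: (measurableT_comp mg (g := fun zyx : Z * Y * X => (zyx.1.1, zyx.2))).
    by apply: measurable_fun_pair => //; exact: (measurableT_comp measurable_fst).
  apply: (measurableT_comp mh (g := fun zyx : Z * Y * X => (zyx.2, zyx.1.2))).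
  by apply: measurable_fun_pair => //; exact: (measurableT_comp measurable_snd).
- by move=> zy x; exact: mule_ge0.
Qed.

Lemma nfold_measurable_mixture n c g :
  0 <= c -> measurable_fun setT g -> (forall x, 0 <= g x) ->
  nfold_measurable mu (@mixture n c g).
Proof.
elim: n c g => [//|n IH] c g c0 mg g0 /=; split.
  move=> y; under eq_fun do rewrite mixture_cons.
  apply: IH => [||x]; last exact: mule_ge0.
  - exact: mule_ge0.
  - by apply: emeasurable_funM => //; exact: (measurable_fun_pair1 y mh).
under eq_fun do under eq_fun do rewrite mixture_cons.
apply: measurable_nfold_mixture => [|||z x]; last exact: mule_ge0.
- exact: emeasurable_funM.
- by move=> y; exact: mule_ge0.
- apply: emeasurable_funM; first exact: (measurableT_comp mg).
  apply: (measurableT_comp mh (g := fun yx : Y * X => (yx.2, yx.1))).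
  by apply: measurable_fun_pair.
Qed.

(** The one-step bound is asked for every weight vanishing off [A]. That class is stable under
    multiplying [g] by [h x y] for fixed [y], so the induction hypothesis applies under the outer
    integral and each observation costs one factor [rho]. *)
Lemma nfold_mixture_le (A : set X) (rho : R) : (0 <= rho)%R ->
  (forall g : X -> \bar R, measurable_fun setT g -> (forall x, 0 <= g x) ->
     (forall x, ~ A x -> g x = 0) ->
     \int[mu]_y (w y * (\int[pi]_x (g x * h x y)) `^ r) <=
       rho%:E * (\int[pi]_x g x) `^ r) ->
  forall n (c : \bar R) (g : X -> \bar R),
    0 <= c -> measurable_fun setT g -> (forall x, 0 <= g x) ->
    (forall x, ~ A x -> g x = 0) ->
    nfold_integral mu (@mixture n c g) <=
      c * (rho ^+ n)%:E * (\int[pi]_x g x) `^ r.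
Proof.
move=> rho0 step; elim=> [|n IH] c g c0 mg g0 gA /=.
  rewrite /mixture big_ord0 !mule1.
  by under eq_integral do rewrite big_ord0 mule1.
have mgh y : measurable_fun setT (fun x => g x * h x y).
  by apply: emeasurable_funM => //; exact: (measurable_fun_pair1 y mh).
apply: (@le_trans _ _ (\int[mu]_y (c * (rho ^+ n)%:E *
    (w y * (\int[pi]_x (g x * h x y)) `^ r)))).
  apply: ge0_le_integralT => y; first by apply: nfold_integral_ge0 => ys; exact: mixture_ge0.
  under eq_fun do rewrite mixture_cons.
  apply: le_trans (IH _ _ _ _ _ _) _ => //.
  - exact: mule_ge0.
  - by move=> x; exact: mule_ge0.
  - by move=> x /gA ->; rewrite mul0e.
  - by rewrite muleA (muleAC c).
rewrite ge0_integralZl//.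
- rewrite exprSr EFinM (muleA c) -(muleA _ rho%:E).
  apply: lee_wpmul2l; last exact: step.
  by rewrite mule_ge0// lee_fin exprn_ge0.
- apply: emeasurable_funM => //; apply: (measurableT_comp (measurable_poweR r)).
  apply: (measurable_fun_fubini_tonelli_G (m1 := pi) (fun z : X * Y => g z.1 * h z.1 z.2)).
    by apply: emeasurable_funM => //; exact: (measurableT_comp mg).
  by move=> z; exact: mule_ge0.
- by move=> y _; rewrite mule_ge0// poweR_ge0.
- by rewrite mule_ge0// lee_fin exprn_ge0.
Qed.

End mixture.

(** * Divergences *)

Section tilt.
Local Open Scope ereal_scope.
Context (R : realType).
Implicit Types (t a b u : R).

(* a ^ (1 + t) b ^ (- t), with the limiting values at 0; unlike
   [divergence_integrand] it is nonnegative. *)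
Definition tilt t a b : \bar R := divergence_integrand t a b + a%:E.

Lemma tiltE t a b : tilt t a b =
  if a == 0%R then 0
  else if b == 0%R then (if (0 < t)%R then +oo else 0)
  else (a * (a / b) `^ t)%:E.
Proof.
rewrite /tilt /divergence_integrand; case: eqP => [->|_]; first by rewrite adde0.
case: eqP => _; last by rewrite -EFinD mulrBr mulr1 subrK.
by case: ifP => _ //; rewrite -EFinD addNr.
Qed.

Lemma tilt_ge0 t a b : (0 <= a)%R -> 0 <= tilt t a b.
Proof.
move=> a0; rewrite tiltE; case: eqP => // _; case: eqP => _; first by case: ifP.
by rewrite lee_fin mulr_ge0// powR_ge0.
Qed.

Lemma tiltM t a b a' b' : (0 < t)%R -> (0 < a)%R -> (0 <= b)%R ->
  (0 < a')%R -> (0 <= b')%R ->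
  tilt t (a * a') (b * b') = tilt t a b * tilt t a' b'.
Proof.
move=> t0 a0 b0 a'0 b'0; rewrite !tiltE !mulf_eq0 (gt_eqF a0) (gt_eqF a'0) t0 /=.
have [->|bn0] := eqVneq b 0%R; have [->|b'n0] //= := eqVneq b' 0%R.
- by rewrite gt0_mulye// lte_fin mulr_gt0// powR_gt0// divr_gt0// lt_neqAle eq_sym b'n0.
- by rewrite gt0_muley// lte_fin mulr_gt0// powR_gt0// divr_gt0// lt_neqAle eq_sym bn0.
have -> : (a * a' / (b * b') = a / b * (a' / b'))%R by rewrite mulf_div.
by rewrite powRM ?divr_ge0 ?(ltW a0) ?(ltW a'0)// -EFinM mulrACA.
Qed.

(** Gives the tilt of two joint likelihoods the product form that [mixture] requires. The invariant
    [K] carries along the sign conditions of [tiltM]. *)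
Lemma tilt_prod t n (a b : 'I_n -> R) : (0 < t)%R ->
  (forall i, 0 < a i)%R -> (forall i, 0 <= b i)%R ->
  \big[mule/1]_(i < n) tilt t (a i) (b i) =
    tilt t (\prod_(i < n) a i) (\prod_(i < n) b i).
Proof.
move=> t0 a0 b0.
pose K (z : \bar R) (x y : R) := [/\ (0 < x)%R, (0 <= y)%R & z = tilt t x y].
suff [] : K (\big[mule/1]_(i < n) tilt t (a i) (b i)) (\prod_(i < n) a i)%R
  (\prod_(i < n) b i)%R by [].
elim/big_ind3 : _ => //.
- by split=> //; rewrite tiltE !oner_eq0 divr1 powR1 mulr1.
- move=> z x y z' x' y' [x0 y0 ->] [x'0 y'0 ->].
  by split; rewrite ?mulr_gt0 ?mulr_ge0 ?tiltM.
Qed.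

(** The integrand of the Hellinger-type affinity of order [u]. The conventions at 0 agree because
    both exponents are positive. *)
Lemma tiltN u a b : (0 < u < 1)%R -> (0 <= a)%R -> (0 <= b)%R ->
  tilt (- u) a b = (a `^ (1 - u) * b `^ u)%:E.
Proof.
move=> /andP[u0 u1] a0 b0; rewrite tiltE.
have [->|an0] := eqVneq a 0%R; first by rewrite powR0 ?mul0r// subr_eq0 gt_eqF.
have [->|bn0] := eqVneq b 0%R; first by rewrite oppr_gt0 ltNge ltW//= powR0 ?mulr0// gt_eqF.
congr EFin; rewrite powRM// ?invr_ge0// mulrA powRD ?an0 ?implybT// powRr1//.
by rewrite -powR_inv1// -powRrM mulN1r opprK.
Qed.

(* The tangent of z ^ (- t) at 1, [1 + t <= z ^ (- t) + t z], at z = b / (a x). *)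
Lemma tilt_tangent t a b x : (0 < t)%R -> (0 < a)%R -> (0 <= b)%R -> (0 < x)%R ->
  ((1 + t) * a)%:E <= (x `^ t)%:E * tilt t a b + (t / x * b)%:E.
Proof.
move=> t0 a0 b0 x0; rewrite tiltE gt_eqF// t0.
have [->|bn0] := eqVneq b 0%R.
  by rewrite mulr0 adde0 gt0_muley ?leey// lte_fin powR_gt0.
have {bn0}b0 : (0 < b)%R by rewrite lt_neqAle eq_sym bn0.
rewrite -EFinM -EFinD lee_fin.
set z := (b / a / x)%R.
have z0 : (0 < z)%R by rewrite !divr_gt0.
have -> : (x `^ t * (a * (a / b) `^ t) + t / x * b = a * (z `^ (- t) + t * z))%R.
  have -> : (- t = -1 * t)%R by rewrite mulN1r.
  rewrite powRrM powR_inv1 ?(ltW z0)// mulrDr mulrCA -powRM ?divr_ge0 ?(ltW x0) ?(ltW a0) ?(ltW b0)//.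
  congr (_ * _ `^ _ + _)%R; rewrite /z; field; rewrite ?(gt_eqF a0) ?(gt_eqF b0) ?(gt_eqF x0)//.
rewrite mulrC ler_pM2l// /powR gt_eqF// mulNr.
(* Since [z ^ (- t) = exp (- t ln z)], the bound [exp s >= 1 + s] is used twice: at [s = - t ln z],
   and at [s = ln z] to get [ln z <= z - 1]. *)
have := expR_ge1Dx (- (t * ln z)); have := expR_ge1Dx (ln z); rewrite lnK ?posrE// => A B.
have : (t * (1 + ln z) <= t * z)%R by rewrite ler_pM2l.
lra.
Qed.

End tilt.

Section divergence.
Local Open Scope ereal_scope.
Context d (Y : measurableType d) (R : realType).

Lemma measurable_divergence_integrand dZ (Z : measurableType dZ) (t : R) (p f : Z -> R) :
  measurable_fun setT p -> measurable_fun setT f -> (forall z, 0 <= p z)%R ->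
  (forall z, 0 <= f z)%R ->
  measurable_fun setT (fun z => divergence_integrand t (p z) (f z)).
Proof.
move=> mp mf p0 f0; rewrite /divergence_integrand.
have m0 (q : Z -> R) : measurable_fun setT q -> measurable_fun setT (fun z => q z == 0%R).
  by move=> mq; apply: measurable_fun_eqr => //; exact: measurable_cst.
apply: measurable_fun_ifT; [exact: m0|exact: measurable_cst|].
apply: measurable_fun_ifT; first exact: m0.
  case: (0 < t)%R; first exact: measurable_cst.
  by apply/measurable_EFinP; exact: measurableT_comp.
apply/measurable_EFinP; apply: measurable_funM => //; apply: measurable_funB => //.
rewrite (_ : (fun z => _) = (fun z => (p z * (f z) `^ (-1)) `^ t)%R); last first.
  by apply/funext => z; rewrite powR_inv1.
apply: (measurableT_comp (measurable_powR t)); apply: measurable_funM => //.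
exact: (measurableT_comp (measurable_powR _)).
Qed.

Lemma measurable_tilt dZ (Z : measurableType dZ) (t : R) (p f : Z -> R) :
  measurable_fun setT p -> measurable_fun setT f -> (forall z, 0 <= p z)%R ->
  (forall z, 0 <= f z)%R ->
  measurable_fun setT (fun z => tilt t (p z) (f z)).
Proof.
move=> mp mf p0 f0; apply: emeasurable_funD; last exact/measurable_EFinP.
exact: measurable_divergence_integrand.
Qed.

(** Adding [p] to the integrand turns it into the tilt. As [p] has the finite integral 1,
    subtracting it is legitimate even when the tilt has infinite integral. *)
Lemma divergenceE (mu : {measure set Y -> \bar R}) (t : R) (p q : Y -> R) :
  is_density mu p -> measurable_fun setT q -> (forall y, 0 <= q y)%R ->
  divergence mu t p q = t^-1%:E * (\int[mu]_y tilt t (p y) (q y) - 1).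
Proof.
move=> [mp p0 p1] mq q0; congr (_ * _).
rewrite integralD_ge0 ?p1 ?addeK ?ltry//.
- exact: measurable_divergence_integrand.
- exact/measurable_EFinP.
- by move=> y; exact: tilt_ge0.
Qed.

End divergence.

(** * One-observation estimates *)

Section powR_extra.
Local Open Scope ereal_scope.
Context (R : realType).
Implicit Types (a b c u : R) (x y : \bar R).

(** A ratio [c / (a + b)] in [0, 1] is at most its [u]-th power. Multiply by [(a + b) ^ u] and add
    the cases [c = a] and [c = b]. *)
Lemma powR_subadditive a b u : (0 < u <= 1)%R -> (0 <= a)%R -> (0 <= b)%R ->
  ((a + b) `^ u <= a `^ u + b `^ u)%R.
Proof.
move=> /andP[u0 u1] a0 b0.
have [ab0|ab0] := eqVneq (a + b)%R 0%R.
  by rewrite ab0 powR0 ?gt_eqF// addr_ge0// powR_ge0.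
have {ab0}s0 : (0 < a + b)%R by rewrite lt_neqAle eq_sym ab0 addr_ge0.
have H c : (0 <= c <= a + b)%R -> (c / (a + b) * (a + b) `^ u <= c `^ u)%R.
  move=> /andP[c0 cs]; have [->|cn0] := eqVneq c 0%R; first by rewrite !mul0r powR_ge0.
  have {cn0}c0' : (0 < c)%R by rewrite lt_neqAle eq_sym cn0.
  rewrite -[in leRHS](@divfK _ (a + b)%R _ c) ?gt_eqF// powRM ?divr_ge0 ?(ltW s0)//.
  rewrite ler_pM2r ?powR_gt0// -[leLHS]powRr1 ?divr_ge0 ?(ltW s0)//.
  by rewrite ger_powR// divr_gt0//= ler_pdivrMr// mul1r.
apply: le_trans (lerD (H a _) (H b _)); rewrite ?a0 ?b0 ?lerDl ?lerDr//.
by rewrite -mulrDl -mulrDl divff ?mul1r// gt_eqF.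
Qed.

Lemma poweR_subadditive x y u : (0 < u <= 1)%R -> 0 <= x -> 0 <= y ->
  (x + y) `^ u <= x `^ u + y `^ u.
Proof.
move=> /[dup] u01 /andP[u0 _].
case: x => [a| |]; case: y => [b| |] //= a0 b0; rewrite ?(gt_eqF u0) ?leey//.
by rewrite -EFinD lee_fin; exact: powR_subadditive.
Qed.

Lemma powR_sum_le (I : Type) (s : seq I) (a : I -> R) u : (0 < u <= 1)%R ->
  (forall i, 0 <= a i)%R -> ((\sum_(i <- s) a i) `^ u <= \sum_(i <- s) a i `^ u)%R.
Proof.
move=> u01 a0; elim: s => [|i s IH].
  by rewrite !big_nil powR0// gt_eqF//; case/andP: u01.
rewrite !big_cons; apply: le_trans (powR_subadditive u01 _ _) _ => //.
  exact: sumr_ge0.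
by rewrite lerD2l.
Qed.

Lemma le_poweR x y u : (0 < u)%R -> 0 <= x -> x <= y -> x `^ u <= y `^ u.
Proof.
move=> u0 x0 xy; apply: gt0_ler_poweR => //; rewrite ?in_itv/= ?x0 ?leey ?(le_trans x0)//.
exact: ltW.
Qed.

(** Young's inequality for the conjugate exponents [1 / u] and [1 / (1 - u)]. *)
Lemma powR_young a b u : (0 < u < 1)%R -> (0 <= a)%R -> (0 <= b)%R ->
  (b `^ (1 - u) * a `^ u <= u * a + (1 - u) * b)%R.
Proof.
move=> /andP[u0 u1] a0 b0.
have v0 : (0 < 1 - u)%R by rewrite subr_gt0.
have := @conjugate_powR R (a `^ u)%R (b `^ (1 - u))%R u^-1%R (1 - u)^-1%R (powR_ge0 _ _) (powR_ge0 _ _).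
rewrite !invr_gt0 !invrK -!powRrM !mulfV ?gt_eqF// !powRr1// => /(_ u0 v0).
by rewrite (mulrC (_ `^ _)%R) (mulrC a) (mulrC b); apply; ring.
Qed.

(** Young's inequality applied to [x / c]. The free scale [c] will be the integral of [x], which
    turns Young into Hoelder. *)
Lemma poweR_young x b c u : (0 < u < 1)%R -> 0 <= x -> (0 <= b)%R -> (0 < c)%R ->
  (b `^ (1 - u))%:E * x `^ u <=
    (c `^ u)%:E * ((u / c)%:E * x + ((1 - u) * b)%:E).
Proof.
move=> u01 x0 b0 c0; have /andP[u0 u1] := u01.
case: x x0 => [a| |] //= a0.
  rewrite -!(EFinM, EFinD) lee_fin.
  rewrite -[in leLHS](@divfK _ c _ a) ?gt_eqF// powRM ?divr_ge0 ?(ltW c0)//.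
  rewrite mulrA [leLHS]mulrC ler_pM2l ?powR_gt0//.
  apply: le_trans (powR_young u01 _ b0) _; first by rewrite divr_ge0// ltW.
  by rewrite mulrA mulrAC.
rewrite (gt_eqF u0) [in leRHS]gt0_muley ?lte_fin ?divr_gt0// addye//.
by rewrite [leRHS]gt0_muley ?leey// lte_fin powR_gt0.
Qed.

End powR_extra.

Section steps.
Local Open Scope ereal_scope.
Context d (Y : measurableType d) (R : realType).

(** Hoelder's inequality with exponents [1 / (1 - u)] and [1 / u], the first factor having norm 1
    because [p] is a density. If [e] has integral at most [c], integrating [poweR_young] at scale
    [c] gives at most [c ^ u * (u + (1 - u))]. *)
Lemma integral_powR_le (mu : {measure set Y -> \bar R}) (p : Y -> R)
    (e : Y -> \bar R) (u : R) :
  (0 < u < 1)%R -> is_density mu p -> measurable_fun setT e -> (forall y, 0 <= e y) ->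
  \int[mu]_y ((p y `^ (1 - u))%:E * e y `^ u) <= (\int[mu]_y e y) `^ u.
Proof.
move=> u01 [mp p0 p1] me e0; have /andP[u0 u1] := u01.
have key (c : R) : (0 < c)%R -> \int[mu]_y e y <= c%:E ->
    \int[mu]_y ((p y `^ (1 - u))%:E * e y `^ u) <= (c `^ u)%:E.
  move=> c0 ec; apply: (@le_trans _ _ (\int[mu]_y ((c `^ u)%:E *
      ((u / c)%:E * e y + (1 - u)%:E * (p y)%:E)))).
    apply: ge0_le_integralT => y; first by rewrite mule_ge0 ?poweR_ge0// lee_fin powR_ge0.
    by rewrite -EFinM; exact: poweR_young.
  have uc0 : (0 <= u / c)%R by rewrite divr_ge0// ltW.
  have v0 : (0 <= 1 - u)%R by rewrite subr_ge0 ltW.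
  rewrite ge0_integralZl_EFin ?powR_ge0//; first last.
  - apply: emeasurable_funD; apply: measurable_funeM => //; exact/measurable_EFinP.
  - by move=> y _; rewrite adde_ge0// mule_ge0 ?lee_fin.
  rewrite ge0_integralD//; first last.
  - by apply: measurable_funeM; exact/measurable_EFinP.
  - by move=> y _; rewrite mule_ge0 ?lee_fin.
  - exact: measurable_funeM.
  - by move=> y _; rewrite mule_ge0 ?lee_fin.
  rewrite !ge0_integralZl_EFin//; last 2 first.
  - by move=> y _; rewrite lee_fin.
  - exact/measurable_EFinP.
  rewrite p1 mule1 -[leRHS]mule1 lee_wpmul2l ?lee_fin ?powR_ge0//.
  apply: (@le_trans _ _ ((u / c)%:E * c%:E + (1 - u)%:E)).
    by rewrite leeD2r// lee_wpmul2l ?lee_fin.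
  by rewrite -EFinM divfK ?gt_eqF// -EFinD addrC subrK.
have [|] := ltP (\int[mu]_y e y) +oo; last by rewrite leye_eq => /eqP ->; rewrite /= gt_eqF// leey.
have : 0 <= \int[mu]_y e y by exact: integral_ge0.
case E : (\int[mu]_y e y) => [a| |] // a0 _.
have [a00|an0] := eqVneq a 0%R; last first.
  by rewrite poweR_EFin key// ?E// lt_neqAle eq_sym an0 -lee_fin.
rewrite a00 poweR_EFin powR0 ?gt_eqF//.
(* The scale must be positive, so a zero integral is bounded by [c = eps ^ (1 / u)], for which
   [c ^ u = eps]. *)
apply/lee_addgt0Pr => eps eps0; rewrite add0e.
have -> : (eps = (eps `^ u^-1) `^ u)%R by rewrite -powRrM mulVf ?gt_eqF// powRr1// ltW.
by apply: key; rewrite ?powR_gt0// E a00 lee_fin powR_ge0.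
Qed.

Context dX (X : measurableType dX).
Variables (pi : {sigma_finite_measure set X -> \bar R})
  (mu : {sigma_finite_measure set Y -> \bar R}) (h : X -> Y -> R) (p : Y -> R).
Hypotheses (mh : measurable_fun setT (fun z : X * Y => h z.1 z.2))
  (h0 : forall x y, (0 <= h x y)%R) (dp : is_density mu p).

(** By Tonelli the left side is the average under [g] of the tilt integrals. The weight 1 and the
    exponent 1 give it the shape of the hypothesis of [nfold_mixture_le]. *)
Lemma tilt_step (A : set X) (t rho : R) : (0 <= rho)%R ->
  (forall x, A x -> \int[mu]_y tilt t (p y) (h x y) <= rho%:E) ->
  forall g : X -> \bar R, measurable_fun setT g -> (forall x, 0 <= g x) ->
    (forall x, ~ A x -> g x = 0) ->
  \int[mu]_y (1 * (\int[pi]_x (g x * tilt t (p y) (h x y))) `^ 1) <=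
    rho%:E * (\int[pi]_x g x) `^ 1.
Proof.
move=> rho0 hA g mg g0 gA; have [mp p0 _] := dp.
have mT : measurable_fun setT (fun z : X * Y => tilt t (p z.2) (h z.1 z.2)).
  by apply: measurable_tilt => //; exact: (measurableT_comp mp).
have F0 (z : X * Y) : 0 <= g z.1 * tilt t (p z.2) (h z.1 z.2).
  by rewrite mule_ge0// tilt_ge0.
under eq_integral => y _.
  rewrite mul1e poweRe1; last by apply: integral_ge0 => x _; exact: (F0 (x, y)).
  over.
rewrite poweRe1 ?integral_ge0//.
rewrite -(fubini_tonelli (fun z : X * Y => g z.1 * tilt t (p z.2) (h z.1 z.2)))//=; last first.
  by apply: emeasurable_funM => //; exact: (measurableT_comp mg).
rewrite -ge0_integralZl_EFin//; apply: ge0_le_integralT => x.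
  by apply: integral_ge0 => y _; exact: (F0 (x, y)).
rewrite ge0_integralZl//; first last.
- by move=> y _; exact: tilt_ge0.
- exact: (measurable_fun_pair2 x mT).
have [Ax|nAx] := pselect (A x); last by rewrite gA// mul0e mule0.
by rewrite muleC lee_wpmul2r// hA.
Qed.

(** For a fixed [x0] in [A], the mixture of the [h x] is at most [M * h x0 + e], where [e] averages
    the deviations from [h x0] and has integral at most [s * M]. Subadditivity of the [u]-th power
    separates the terms: the first contributes [rho * M ^ u], the second [(s * M) ^ u] by
    [integral_powR_le]. *)
Lemma mixture_step (A : set X) (u rho s : R) :
  (0 < u < 1)%R -> (0 <= rho)%R -> (0 <= s)%R ->
  (forall x, A x -> \int[mu]_y tilt (- u) (p y) (h x y) <= rho%:E) ->
  (forall x x', A x -> A x' -> \int[mu]_y (`|h x y - h x' y|)%:E <= s%:E) ->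
  forall g : X -> \bar R, measurable_fun setT g -> (forall x, 0 <= g x) ->
    (forall x, ~ A x -> g x = 0) ->
  \int[mu]_y ((p y `^ (1 - u))%:E * (\int[pi]_x (g x * (h x y)%:E)) `^ u) <=
    (rho + s `^ u)%:E * (\int[pi]_x g x) `^ u.
Proof.
move=> u01 rho0 s0 hA hs g mg g0 gA; have [mp p0 _] := dp; have /andP[u0 u1] := u01.
have [[x0 Ax0]|nA] := pselect (exists x, A x); last first.
  rewrite integral0_eq ?mule_ge0 ?poweR_ge0 ?lee_fin ?addr_ge0 ?powR_ge0// => y _.
  rewrite integral0_eq ?poweR0r ?mule0 ?gt_eqF// => x _.
  by rewrite gA ?mul0e// => Ax; apply: nA; exists x.
set M := \int[pi]_x g x; have M0 : 0 <= M by exact: integral_ge0.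
pose D (z : X * Y) := g z.1 * (`|h z.1 z.2 - h x0 z.2|)%:E.
have mhx x : measurable_fun setT (h x) by exact: (measurable_fun_pair2 x mh).
have mhy y : measurable_fun setT (h ^~ y) by exact: (measurable_fun_pair1 y mh).
have mdiff : measurable_fun setT (fun z : X * Y => (`|h z.1 z.2 - h x0 z.2|)%:E).
  apply/measurable_EFinP; apply: measurableT_comp => //.
  by apply: measurable_funB => //; exact: (measurableT_comp (mhx x0)).
have mD : measurable_fun setT D.
  by apply: emeasurable_funM => //; exact: (measurableT_comp mg).
have D0 z : 0 <= D z by rewrite mule_ge0// lee_fin.
pose e y := \int[pi]_x D (x, y).
have e0 y : 0 <= e y by exact: integral_ge0.
have me : measurable_fun setT e by exact: (measurable_fun_fubini_tonelli_G D).
have ie : \int[mu]_y e y <= s%:E * M.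
  rewrite /e -fubini_tonelli// /M -ge0_integralZl_EFin//.
  apply: ge0_le_integralT => x; first exact: integral_ge0.
  rewrite /D /= ge0_integralZl//; last exact: (measurable_fun_pair2 x mdiff).
  have [Ax|nAx] := pselect (A x); last by rewrite gA// mul0e mule0.
  by rewrite muleC lee_wpmul2r// hs.
have mixle y : \int[pi]_x (g x * (h x y)%:E) <= M * (h x0 y)%:E + e y.
  rewrite /M -ge0_integralZr// ?lee_fin// -ge0_integralD//; first last.
  - exact: (measurable_fun_pair1 y mD).
  - by apply: emeasurable_funM => //; exact: measurable_cst.
  - by move=> x _; rewrite mule_ge0// lee_fin.
  apply: ge0_le_integralT => x; first by rewrite mule_ge0// lee_fin.
  rewrite -ge0_muleDr ?lee_fin// lee_wpmul2l// lee_fin.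
  by rewrite -lerBlDl ler_norm.
have tilt0 y : 0 <= tilt (- u) (p y) (h x0 y) by exact: tilt_ge0.
have mtilt : measurable_fun setT (fun y => tilt (- u) (p y) (h x0 y)) by exact: measurable_tilt.
have mpe : measurable_fun setT (fun y => (p y `^ (1 - u))%:E * e y `^ u).
  apply: emeasurable_funM; last exact: (measurableT_comp (measurable_poweR u)).
  by apply/measurable_EFinP; exact: (measurableT_comp (measurable_powR _)).
have pe0 y : 0 <= (p y `^ (1 - u))%:E * e y `^ u.
  by rewrite mule_ge0 ?poweR_ge0// lee_fin powR_ge0.
apply: (@le_trans _ _ (\int[mu]_y (M `^ u * tilt (- u) (p y) (h x0 y) +
    (p y `^ (1 - u))%:E * e y `^ u))).
  apply: ge0_le_integralT => y; first by rewrite mule_ge0 ?poweR_ge0// lee_fin powR_ge0.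
  rewrite tiltN// EFinM muleCA -(poweR_EFin (h x0 y)) -poweRM// ?lee_fin// -ge0_muleDr ?poweR_ge0//.
  apply: lee_wpmul2l; first by rewrite lee_fin powR_ge0.
  have Mh0 : 0 <= M * (h x0 y)%:E by rewrite mule_ge0 ?lee_fin.
  have u01' : (0 < u <= 1)%R by rewrite u0 ltW.
  apply: (le_trans _ (poweR_subadditive u01' Mh0 (e0 y))).
  by apply: le_poweR => //; apply: integral_ge0 => x _; rewrite mule_ge0 ?lee_fin.
rewrite ge0_integralD//; first last.
- exact: measurable_funeM.
- by move=> y _; rewrite mule_ge0 ?poweR_ge0.
rewrite ge0_integralZl ?poweR_ge0// EFinD ge0_muleDl ?lee_fin ?powR_ge0//.
apply: leeD; first by rewrite muleC lee_wpmul2r ?poweR_ge0// hA.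
apply: le_trans (integral_powR_le u01 dp me e0) _.
rewrite -(poweR_EFin s) -poweRM ?lee_fin//.
by apply: le_poweR => //; exact: integral_ge0.
Qed.
End steps.

(** * Posterior mass for a sigma-finite dominating measure *)

Section posterior_bound.
Local Open Scope ereal_scope.
Context dX (X : measurableType dX) d (Y : measurableType d) (R : realType).
Variables (pi : probability X R) (mu : {sigma_finite_measure set Y -> \bar R}).
Variables (h : X -> Y -> R) (p : Y -> R).
Hypotheses (mh : measurable_fun setT (fun z : X * Y => h z.1 z.2))
  (h0 : forall x y, (0 <= h x y)%R) (dp : is_density mu p).

(** The evidence of [A], with the indicator as a weight: this is how [mixture] takes [g]. *)
Definition mass n (A : set X) (ys : n.-tuple Y) : \bar R :=
  \int[pi]_x ((\1_A x)%:E * (likelihood (h x) ys)%:E).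

Lemma likelihood_ge0 n (ys : n.-tuple Y) (f : Y -> R) :
  (forall y, (0 <= f y)%R) -> (0 <= likelihood f ys)%R.
Proof. by move=> f0; apply: prodr_ge0. Qed.

Lemma measurable_likelihood n (ys : n.-tuple Y) :
  measurable_fun setT (fun x => likelihood (h x) ys).
Proof.
by apply: measurable_prod => i _; exact: (measurable_fun_pair1 _ mh).
Qed.

Lemma mass_ge0 n (A : set X) (ys : n.-tuple Y) : 0 <= mass A ys.
Proof.
by apply: integral_ge0 => x _; rewrite mule_ge0 ?lee_fin// likelihood_ge0.
Qed.

Lemma measurable_mass_integrand n (A : set X) (ys : n.-tuple Y) : measurable A ->
  measurable_fun setT (fun x => (\1_A x)%:E * (likelihood (h x) ys)%:E).
Proof.
move=> mA; apply: emeasurable_funM; apply/measurable_EFinP => //.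
exact: measurable_likelihood.
Qed.

Lemma le_mass n (A B : set X) (ys : n.-tuple Y) : A `<=` B -> mass A ys <= mass B ys.
Proof.
move=> AB; apply: ge0_le_integralT => x.
  by rewrite mule_ge0 ?lee_fin// likelihood_ge0.
rewrite lee_wpmul2r ?lee_fin ?likelihood_ge0// !indicE.
by have [/set_mem/AB/mem_set ->|] := boolP (x \in A).
Qed.

Lemma le_mass_bigcup n m (A : set X) (B : 'I_m -> set X) (ys : n.-tuple Y) :
  (forall j, measurable (B j)) -> A `<=` \bigcup_j B j ->
  mass A ys <= \sum_(j < m) mass (B j) ys.
Proof.
move=> mB AB; rewrite /mass -ge0_integral_sum//; last 2 first.
- by move=> j; exact: measurable_mass_integrand.
- by move=> j x _; rewrite mule_ge0 ?lee_fin// likelihood_ge0.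
apply: ge0_le_integralT => x; first by rewrite mule_ge0 ?lee_fin// likelihood_ge0.
rewrite -ge0_sume_distrl//.
rewrite lee_wpmul2r ?lee_fin ?likelihood_ge0//.
have [/set_mem Ax|nAx] := boolP (x \in A); last first.
  by rewrite indicE (negbTE nAx) sume_ge0// => j _; rewrite lee_fin.
have [j _ Bj] := AB _ Ax.
rewrite (bigD1 j)//= !indicE (mem_set Ax) (mem_set Bj) leeDl//.
by apply: sume_ge0 => i _; rewrite lee_fin.
Qed.

(** Degenerate denominators are covered: an infinite one has inverse 0, and a zero one forces a zero
    numerator, with [0 * +oo = 0]. *)
Lemma mass_ratio_le1 n (A Q : set X) (ys : n.-tuple Y) : A `<=` Q ->
  mass A ys / mass Q ys <= 1.
Proof.
move=> /(@le_mass n _ _ ys); have := mass_ge0 A ys; have := mass_ge0 Q ys.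
case: (mass A ys) => [a| |]; case: (mass Q ys) => [b| |] //=; rewrite ?invey ?mule0 ?lee_fin ?ler01 ?lee01//.
move=> b0 a0 ab; rewrite inver; case: eqP => [b00|/eqP bn0].
  by rewrite (_ : a = 0%R) ?mul0e ?lee01//; apply/eqP; rewrite eq_le a0 -b00 ab.
by rewrite -EFinM lee_fin ler_pdivrMr ?mul1r// lt_neqAle eq_sym bn0.
Qed.

(** With [L] the likelihood of [p], integrating [tilt_tangent] over [K] bounds [(1 + t) * L * pi K]
    by [x0 ^ t] times the tilted integral plus [t / x0] times the evidence of [K]. When that
    evidence is below [pi K * x0 * L], the last term is at most [t * L * pi K], which leaves
    [L * pi K] on the left. *)
Lemma tilt_mass_ge n (K : set X) (t x0 : R) (ys : n.-tuple Y) :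
  measurable K -> (0 < t)%R -> (0 < x0)%R -> (0 < pi K) ->
  (0 < likelihood p ys)%R ->
  mass K ys < (fine (pi K) * x0 * likelihood p ys)%:E ->
  (likelihood p ys)%:E <= (x0 `^ t / fine (pi K))%:E *
    \int[pi]_x ((\1_K x)%:E * tilt t (likelihood p ys) (likelihood (h x) ys)).
Proof.
move=> mK t0 x00 K0 L0; set L := likelihood p ys in L0 *.
have Kfin : pi K \is a fin_num by exact: fin_num_measure.
set k := fine (pi K); have k0 : (0 < k)%R by rewrite fine_gt0// K0 -ge0_fin_numE.
set T := \int[pi]_x _; have T0 : 0 <= T.
  by apply: integral_ge0 => x _; rewrite mule_ge0 ?lee_fin// tilt_ge0// ltW.
move=> mKL.
have key : ((1 + t) * L * k)%:E <= (x0 `^ t)%:E * T + (t / x0)%:E * mass K ys.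
  have mT : measurable_fun setT (fun x => (\1_K x)%:E * tilt t L (likelihood (h x) ys)).
    apply: emeasurable_funM; first exact/measurable_EFinP.
    apply: measurable_tilt => //; first exact: measurable_likelihood.
    - by move=> _; rewrite ltW.
    - by move=> x; exact: likelihood_ge0.
  have tx0 : (0 <= t / x0)%R by rewrite divr_ge0// ltW.
  rewrite /T /mass -!ge0_integralZl_EFin ?powR_ge0//; last 3 first.
  - by move=> x _; rewrite mule_ge0 ?lee_fin// likelihood_ge0.
  - exact: measurable_mass_integrand.
  - by move=> x _; rewrite mule_ge0 ?lee_fin// tilt_ge0// ltW.
  rewrite -ge0_integralD//; last 4 first.
  - by move=> x _; rewrite !mule_ge0 ?lee_fin ?powR_ge0// tilt_ge0// ltW.
  - exact: measurable_funeM.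
  - by move=> x _; rewrite !mule_ge0 ?lee_fin// likelihood_ge0.
  - by apply: measurable_funeM; exact: measurable_mass_integrand.
  have piK : pi K = \int[pi]_x (\1_K x)%:E by rewrite integral_indic// setIT.
  rewrite EFinM /k fineK// piK -ge0_integralZl_EFin//; last 2 first.
  - exact/measurable_EFinP.
  - by rewrite mulr_ge0 ?addr_ge0// ltW.
  apply: ge0_le_integralT => x; first by rewrite mule_ge0 ?lee_fin ?mulr_ge0 ?addr_ge0// ltW.
  rewrite indicE; case: (x \in K); last by rewrite !mul0e !mule0 adde0.
  rewrite !mul1e mule1; apply: tilt_tangent => //; exact: likelihood_ge0.
have := mass_ge0 K ys; move: mKL key; case: (mass K ys) => [m| |]//.
case: (T) T0 => [T'| |]// T0 mL key m0; last first.
  by rewrite gt0_muley ?leey// lte_fin divr_gt0 ?powR_gt0.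
move: T0 mL key m0; rewrite -!EFinM -!EFinD lee_fin lte_fin !lee_fin => T0 mL key m0.
rewrite mulrAC ler_pdivlMr//.
have : (t / x0 * m <= t / x0 * (k * x0 * L))%R by rewrite ler_pM2l ?divr_gt0// ltW.
have -> : (t / x0 * (k * x0 * L) = t * L * k)%R by field; rewrite gt_eqF.
lra.
Qed.

Lemma prod_EFin n (a : 'I_n -> R) :
  \big[mule/1]_(i < n) (a i)%:E = (\prod_(i < n) a i)%:E.
Proof. by rewrite (big_morph EFin EFinM erefl). Qed.

Lemma prod_powR n (a : 'I_n -> R) (r : R) : (forall i, 0 <= a i)%R ->
  (\prod_(i < n) (a i `^ r) = (\prod_(i < n) a i) `^ r)%R.
Proof.
move=> a0; pose K (x y : R) := (0 <= y /\ x = y `^ r)%R.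
suff [] : K (\prod_(i < n) (a i `^ r))%R (\prod_(i < n) a i)%R by [].
elim/big_ind2 : _ => // [|x y x' y' [y0 ->] [y'0 ->]]; first by split=> //; rewrite powR1.
by split; [exact: mulr_ge0|rewrite powRM].
Qed.

Lemma mixture_likelihoodE n (B : set X) (u : R) (c : \bar R) (ys : n.-tuple Y) :
  mixture pi (fun x y => (h x y)%:E) (fun y => (p y `^ (1 - u))%:E) u c
    (fun x => (\1_B x)%:E) ys =
  c * (mass B ys) `^ u * (likelihood p ys `^ (1 - u))%:E.
Proof.
have [_ p0 _] := dp.
rewrite /mixture prod_EFin prod_powR//; congr (_ * _ `^ _ * _).
by apply: eq_integral => x _; rewrite prod_EFin.
Qed.

Lemma mixture_tiltE n (K : set X) (t : R) (c : \bar R) (ys : n.-tuple Y) :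
  (0 < t)%R -> (0 < likelihood p ys)%R ->
  mixture pi (fun x y => tilt t (p y) (h x y)) (cst 1) 1 c
    (fun x => (\1_K x)%:E) ys =
  c * \int[pi]_x ((\1_K x)%:E * tilt t (likelihood p ys) (likelihood (h x) ys)).
Proof.
move=> t0 L0; have [_ p0 _] := dp.
have pi0 i : (0 < p (tnth ys i))%R.
  rewrite lt_neqAle p0 andbT eq_sym; apply: contraTneq L0 => pi0.
  by rewrite /likelihood (bigD1 i)//= pi0 mul0r ltxx.
rewrite /mixture big1_eq mule1 poweRe1.
  by congr (_ * _); apply: eq_integral => x _; rewrite tilt_prod.
apply: integral_ge0 => x _; rewrite mule_ge0 ?lee_fin// tilt_prod//.
by rewrite tilt_ge0// ltW.
Qed.

Lemma posterior_pointwise_le n m (A K Q : set X) (B : 'I_m -> set X)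
    (t u x0 : R) (ys : n.-tuple Y) :
  measurable K -> (forall j, measurable (B j)) ->
  A `<=` Q -> K `<=` Q -> A `<=` \bigcup_j B j ->
  (0 < t)%R -> (0 < u < 1)%R -> (0 < x0)%R -> 0 < pi K ->
  mass A ys / mass Q ys * (likelihood p ys)%:E <=
    mixture pi (fun x y => tilt t (p y) (h x y)) (cst 1) 1
      (x0 `^ t / fine (pi K))%:E (fun x => (\1_K x)%:E) ys +
    \sum_(j < m) mixture pi (fun x y => (h x y)%:E) (fun y => (p y `^ (1 - u))%:E) u
      ((fine (pi K) * x0) `^ (- u))%:E (fun x => (\1_(B j) x)%:E) ys.
Proof.
move=> mK mB AQ KQ AB t0 u01 x00 K0; have [_ p0 _] := dp; have /andP[u0 u1] := u01.
have k0 : (0 < fine (pi K))%R by rewrite fine_gt0// K0 -ge0_fin_numE// fin_num_measure.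
have c10 : 0 <= (x0 `^ t / fine (pi K))%:E by rewrite lee_fin divr_ge0 ?powR_ge0// ltW.
have m1 : 0 <= mixture pi (fun x y => tilt t (p y) (h x y)) (cst 1) 1
      (x0 `^ t / fine (pi K))%:E (fun x => (\1_K x)%:E) ys.
  by apply: mixture_ge0 => // x; rewrite ?lee01.
have m2 : 0 <= \sum_(j < m) mixture pi (fun x y => (h x y)%:E) (fun y => (p y `^ (1 - u))%:E) u
      ((fine (pi K) * x0) `^ (- u))%:E (fun x => (\1_(B j) x)%:E) ys.
  apply: sume_ge0 => j _; apply: mixture_ge0 => [y|]; by rewrite lee_fin powR_ge0.
have [L0|L0] := eqVneq (likelihood p ys) 0%R; first by rewrite L0 mule0 adde_ge0.
have {}L0 : (0 < likelihood p ys)%R by rewrite lt_neqAle eq_sym L0 likelihood_ge0.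
(* The split is on the evidence of [K] rather than of [Q]: as [K] lies in [Q], large evidence of [K]
   bounds the denominator from below. *)
have [Ksmall|Kbig] := ltP (mass K ys) (fine (pi K) * x0 * likelihood p ys)%:E.
  apply: le_trans (leeDl _ m2); rewrite mixture_tiltE//.
  apply: le_trans (tilt_mass_ge mK t0 x00 K0 L0 Ksmall).
  by rewrite -[leRHS]mul1e lee_wpmul2r ?mass_ratio_le1// lee_fin ltW.
apply: le_trans (leeDr _ m1).
under eq_bigr do rewrite mixture_likelihoodE.
have := le_mass ys AQ; have := le_trans Kbig (le_mass ys KQ).
have := mass_ge0 A ys; have := le_mass_bigcup ys mB AB.
set L := likelihood p ys in L0 *.
have dL0 : (0 < fine (pi K) * x0 * L)%R by rewrite !mulr_gt0.
case: (mass Q ys) => [q| |] //; last first.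
  move=> _ _ _ _; rewrite invey mule0 mul0e.
  by apply: sume_ge0 => j _; rewrite !mule_ge0 ?poweR_ge0 ?lee_fin ?powR_ge0.
move=> Aj A0 Lq Aq; have q0 : (0 < q)%R by rewrite -lte_fin (lt_le_trans _ Lq)// lte_fin.
have [a Ea] : exists a, mass A ys = a%:E.
  by move: Aq A0; case: (mass A ys) => [a| |] //; exists a.
move: Aj A0 Aq; rewrite Ea !lee_fin => Aj a0 aq.
(* An infinite evidence of some [B j] makes the right side infinite; otherwise all quantities are
   real. *)
have [/existsP[j /eqP Bj]|/existsPn Bfin] := boolP [exists j, mass (B j) ys == +oo].
  rewrite (bigD1 j)//= Bj [in leRHS]poweRyr ?gt_eqF// gt0_muley ?lte_fin ?powR_gt0 ?mulr_gt0//.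
  rewrite gt0_mulye ?lte_fin ?powR_gt0// addye ?leey// gt_eqF// (@lt_le_trans _ _ 0) ?ltNy0//.
  by apply: sume_ge0 => i _; rewrite !mule_ge0 ?poweR_ge0 ?lee_fin ?powR_ge0.
pose b j := fine (mass (B j) ys).
have bE j : mass (B j) ys = (b j)%:E.
  by rewrite /b fineK// ge0_fin_numE ?mass_ge0// lt_neqAle Bfin leey.
have b0 j : (0 <= b j)%R by rewrite fine_ge0// mass_ge0.
under eq_bigr do rewrite bE poweR_EFin -!EFinM.
have {}Aj : (a <= \sum_(j < m) b j)%R.
  by rewrite -lee_fin -sumEFin; under eq_bigr do rewrite -bE.
rewrite sumEFin inver gt_eqF// -!EFinM lee_fin.
rewrite -mulr_suml -mulr_sumr.
have aqu : (a / q <= (a / q) `^ u)%R.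
  have [->|an0] := eqVneq a 0%R; first by rewrite mul0r powR_ge0.
  have a0' : (0 < a)%R by rewrite lt_neqAle eq_sym an0.
  rewrite -[leLHS]powRr1 ?divr_ge0 ?(ltW q0)//.
  by rewrite ger_powR// ?divr_gt0 ?ler_pdivrMr ?mul1r// ltW.
apply: (@le_trans _ _ ((a / q) `^ u * L)%R); first by rewrite ler_wpM2r// ltW.
(* The factor [L ^ u] is absorbed by [(a / q) ^ u]: as [q >= pi K * x0 * L], their product is at
   most [(a / (pi K * x0)) ^ u]. The factor [L ^ (1 - u)] is the weight of the mixture. *)
have LE : (L = L `^ u * L `^ (1 - u))%R.
  by rewrite -powRD ?(gt_eqF L0) ?implybT// addrC subrK powRr1// ltW.
rewrite [in leLHS]LE mulrA ler_wpM2r ?powR_ge0//.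
apply: (@le_trans _ _ ((fine (pi K) * x0) `^ (- u) * a `^ u)%R); last first.
  rewrite ler_wpM2l ?powR_ge0//.
  apply: (@le_trans _ _ ((\sum_(j < m) b j) `^ u)%R).
    by rewrite ge0_ler_powR ?nnegrE ?(ltW u0) ?sumr_ge0.
  by apply: powR_sum_le => //; rewrite u0 ltW.
have -> : ((fine (pi K) * x0) `^ (- u) = (fine (pi K) * x0)^-1 `^ u)%R.
  by rewrite -(mulN1r u) powRrM powR_inv1// ltW// mulr_gt0.
have d0 : (0 <= (fine (pi K) * x0)^-1)%R by rewrite invr_ge0 ltW// mulr_gt0.
have aq0 : (0 <= a / q)%R by rewrite divr_ge0// ltW.
rewrite -(powRM u aq0 (ltW L0)) -(powRM u d0 a0).
apply: ge0_ler_powR; rewrite ?nnegrE ?(ltW u0) ?(mulr_ge0 aq0 (ltW L0)) ?(mulr_ge0 d0 a0)//.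
rewrite mulrAC ler_pdivrMr// mulrAC mulrC ler_wpM2r//.
by rewrite ler_pdivlMl ?mulr_gt0// -lee_fin.
Qed.

Lemma nfold_posterior_le n m (A K Q : set X) (B : 'I_m -> set X)
    (t u x0 rho1 rho s : R) :
  measurable K -> (forall j, measurable (B j)) ->
  A `<=` Q -> K `<=` Q -> A `<=` \bigcup_j B j ->
  (0 < t)%R -> (0 < u < 1)%R -> (0 < x0)%R -> 0 < pi K ->
  (0 <= rho1)%R -> (0 <= rho)%R -> (0 <= s)%R ->
  (forall x, K x -> \int[mu]_y tilt t (p y) (h x y) <= rho1%:E) ->
  (forall j x, B j x -> \int[mu]_y tilt (- u) (p y) (h x y) <= rho%:E) ->
  (forall j x x', B j x -> B j x' ->
     \int[mu]_y (`|h x y - h x' y|)%:E <= s%:E) ->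
  nfold_integral mu (fun ys : n.-tuple Y =>
    mass A ys / mass Q ys * (likelihood p ys)%:E) <=
  (x0 `^ t * rho1 ^+ n +
   m%:R * ((fine (pi K) * x0) `^ (- u) * (rho + s `^ u) ^+ n))%:E.
Proof.
move=> mK mB AQ KQ AB t0 u01 x00 K0 rho10 rho0 s0 HK HB Hs.
have [mp p0 _] := dp; have /andP[u0 u1] := u01.
have k0 : (0 < fine (pi K))%R by rewrite fine_gt0// K0 -ge0_fin_numE// fin_num_measure.
have c10 : 0 <= (x0 `^ t / fine (pi K))%:E by rewrite lee_fin divr_ge0 ?powR_ge0// ltW.
have c20 : 0 <= ((fine (pi K) * x0) `^ (- u))%:E by rewrite lee_fin powR_ge0.
have mtilt : measurable_fun setT (fun z : X * Y => tilt t (p z.2) (h z.1 z.2)).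
  by apply: measurable_tilt => //; exact: (measurableT_comp mp).
have tilt0 x y : 0 <= tilt t (p y) (h x y) by exact: tilt_ge0.
have mhE : measurable_fun setT (fun z : X * Y => (h z.1 z.2)%:E) by exact/measurable_EFinP.
have hE0 x y : 0 <= (h x y)%:E by rewrite lee_fin.
have mw : measurable_fun setT (fun y => (p y `^ (1 - u))%:E).
  by apply/measurable_EFinP; exact: (measurableT_comp (measurable_powR _)).
have w0 y : 0 <= (p y `^ (1 - u))%:E by rewrite lee_fin powR_ge0.
have m1 (C : set X) : measurable C -> measurable_fun setT (fun x => (\1_C x)%:E : \bar R).
  by move=> mC; exact/measurable_EFinP.
have i0 (C : set X) x : 0 <= (\1_C x)%:E :> \bar R by rewrite lee_fin.
have iN (C : set X) x : ~ C x -> (\1_C x)%:E = 0 :> \bar R.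
  by move=> Cx; rewrite indicE memNset.
have piE (C : set X) : measurable C -> \int[pi]_x (\1_C x)%:E = pi C.
  by move=> mC; rewrite integral_indic// setIT.
pose F1 := @mixture _ X _ Y R pi (fun x y => tilt t (p y) (h x y)) (cst 1) 1 n
  (x0 `^ t / fine (pi K))%:E (fun x => (\1_K x)%:E).
pose F2 j := @mixture _ X _ Y R pi (fun x y => (h x y)%:E) (fun y => (p y `^ (1 - u))%:E) u n
  ((fine (pi K) * x0) `^ (- u))%:E (fun x => (\1_(B j) x)%:E).
have F10 ys : 0 <= F1 ys by apply: mixture_ge0 => // x; rewrite lee01.
have F20 j ys : 0 <= F2 j ys by exact: mixture_ge0.
apply: (@le_trans _ _ (nfold_integral mu (fun ys => F1 ys + \sum_(j < m) F2 j ys))).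
  apply: le_nfold_integral => ys; last exact: posterior_pointwise_le.
  rewrite mule_ge0 ?lee_fin ?likelihood_ge0// mule_ge0 ?mass_ge0//.
  by rewrite inve_ge0 mass_ge0.
have [mS eS] : nfold_measurable mu (fun ys => \sum_(j < m) F2 j ys) /\
    nfold_integral mu (fun ys => \sum_(j < m) F2 j ys) = \sum_(j < m) nfold_integral mu (F2 j).
  apply: nfold_integral_sum => // j.
  by apply: nfold_measurable_mixture => //; exact: m1.
have mF1 : nfold_measurable mu F1.
  by apply: nfold_measurable_mixture => //; exact: m1.
have S0 ys : 0 <= \sum_(j < m) F2 j ys by exact: sume_ge0.
rewrite (nfold_integralD F10 S0 mF1 mS).2 eS EFinD; apply: leeD.
  have step := tilt_step (t := t) pi mh h0 dp rho10 HK.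
  have w1 (y : Y) : 0 <= (cst 1 y : \bar R) by exact: lee01.
  have mw1 : measurable_fun setT (cst 1 : Y -> \bar R) by exact: measurable_cst.
  apply: le_trans (nfold_mixture_le mtilt tilt0 mw1 w1 rho10 step n c10 (m1 _ mK) (i0 K) (@iN K)) _.
  (* The prior mass of [K] cancels the [pi K] in the denominator of the constant. *)
  rewrite piE// poweRe1// -[in leLHS](@fineK _ (pi K)) ?fin_num_measure//.
  by rewrite -!EFinM lee_fin mulrAC divfK// gt_eqF.
rewrite mulr_natl -[in leRHS](card_ord m) -sumr_const -sumEFin; apply: lee_sum => j _.
have step := mixture_step pi mh h0 dp u01 rho0 s0 (HB j) (Hs j).
have rs0 : (0 <= rho + s `^ u)%R by rewrite addr_ge0// powR_ge0.
apply: le_trans (nfold_mixture_le mhE hE0 mw w0 rs0 step n c20 (m1 _ (mB j)) (i0 (B j)) (@iN (B j))) _.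
(* The prior mass of [B j] enters as [pi (B j) ^ u] and is bounded by 1. *)
rewrite piE// EFinM -[leRHS]mule1; apply: lee_wpmul2l.
  by rewrite mule_ge0// lee_fin exprn_ge0.
rewrite -[leRHS](poweR1r u); apply: le_poweR => //; exact: probability_le1.
Qed.

End posterior_bound.

(** * Restriction to the support of a density *)

Section support_restriction.
Local Open Scope ereal_scope.
Context d (Y : measurableType d) (R : realType) (mu : {measure set Y -> \bar R}).
Variables (p : Y -> R) (dp : is_density mu p).

Let measurable_gt (c : R) : measurable [set y | (c < p y)%R].
Proof.
have [/measurable_EFinP mp _ _] := dp.
have := emeasurable_fun_o_infty measurableT mp c%:E.
by rewrite setTI; congr measurable; apply/seteqP; split => y; rewrite /= lte_fin.
Qed.

Lemma measurable_density_support : measurable [set y | (0 < p y)%R].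
Proof. exact: measurable_gt. Qed.

Definition mu_support := mrestr mu measurable_density_support.

HB.instance Definition _ := Measure.on mu_support.

(** The zero set of [p] is null for the restricted measure, and by Markov's inequality the set where
    [p > 1 / (k + 1)] has measure at most [k + 1]. *)
Let mu_support_sigma_finite : sigma_finite setT mu_support.
Proof.
have [mp p0 p1] := dp.
exists (fun k : nat => [set y | (p y = 0)%R] `|` [set y | (k.+1%:R^-1 < p y)%R]).
  apply/esym/seteqP; split => // y _.
  have [py0|pyn0] := eqVneq (p y) 0%R; first by exists 0%N => //; left.
  have py : (0 < p y)%R by rewrite lt_neqAle eq_sym pyn0 p0.
  have [k _ /(_ k (leqnn k)) /= kp] := near_infty_natSinv_lt (PosNum py).
  by exists k => //; right.
move=> k.
have mk := measurable_gt k.+1%:R^-1.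
have m0 : measurable [set y | (p y = 0)%R].
  rewrite (_ : [set y | _] = ~` [set y | (0 < p y)%R]).
    exact/measurableC/measurable_density_support.
  apply/seteqP; split => y /=; first by move=> ->; rewrite ltxx.
  by move=> /negP; rewrite -leNgt => py0; apply/eqP; rewrite eq_le py0 p0.
split; first exact: measurableU.
rewrite /mu_support /mrestr.
apply: (@le_lt_trans _ _ (mu [set y | (k.+1%:R^-1 < p y)%R])).
  apply: le_measure; rewrite ?inE//.
    by apply: measurableI; [exact: measurableU|exact: measurable_density_support].
  by move=> y /= [[->|//]]; rewrite ltxx.
have k0 : (0 < k.+1%:R^-1 :> R)%R by rewrite invr_gt0.
have mk_le : k.+1%:R^-1%:E * mu [set y | (k.+1%:R^-1 < p y)%R] <= 1.
  rewrite -p1 -[X in mu X]setIT -integral_indic// -ge0_integralZl_EFin ?(ltW k0)//; last first.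
    by apply/measurable_EFinP.
  apply: ge0_le_integralT => y; first by rewrite mule_ge0 ?lee_fin// ltW.
  rewrite indicE -EFinM lee_fin.
  have [|_] := boolP (y \in _); last by rewrite mulr0.
  by rewrite inE /= mulr1 => /ltW.
case: (mu _) mk_le => [r _| |//]; first by rewrite ltry.
by rewrite gt0_muley.
Qed.

HB.instance Definition _ :=
  Measure_isSigmaFinite.Build _ _ _ mu_support mu_support_sigma_finite.

Lemma integral_mu_support (f : Y -> \bar R) : (forall y, p y = 0%R -> f y = 0) ->
  \int[mu_support]_y f y = \int[mu]_y f y.
Proof.
have [_ p0 _] := dp; move=> f0; apply: integral_mrestrT => y /negP.
rewrite /= -leNgt => py0; apply: f0; apply/eqP; rewrite eq_le py0 p0//.
Qed.

(** For L1 distances, whose integrand need not vanish off the support: restriction can only decrease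
    them. *)
Lemma le_integral_mu_support (f : Y -> \bar R) :
  measurable_fun setT f -> (forall y, 0 <= f y) ->
  \int[mu_support]_y f y <= \int[mu]_y f y.
Proof.
move=> mf f0; apply: ge0_le_measure_integral => // S mS.
apply: le_measure; rewrite ?inE//.
by apply: measurableI => //; exact: measurable_density_support.
Qed.

Lemma nfold_integral_mu_support n (F : n.-tuple Y -> \bar R) :
  nfold_integral mu_support (fun ys => F ys * (likelihood p ys)%:E) =
  iid_integral mu p F.
Proof.
have [_ p0 _] := dp; apply: nfold_integral_mrestr => ys i /negP.
rewrite -leNgt => pi0; rewrite /likelihood (bigD1 i)//=.
by rewrite (_ : p (tnth ys i) = 0%R) ?mul0r ?mule0//; apply/eqP; rewrite eq_le pi0 p0.
Qed.

Lemma density_mu_support : is_density mu_support p.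
Proof.
have [mp p0 p1] := dp; split=> //.
by rewrite integral_mu_support // => y ->.
Qed.

End support_restriction.

(** Telescoping: [1 / x ^ 2 <= 2 (1 / x - 1 / (x + 1))] for [x >= 1], so the partial sums stay below
    [2 * C]. *)
Lemma nneseries_inv_sqr_lty (R : realType) (a : nat -> \bar R) (C : R) :
  (0 <= C)%R -> (forall n, 0 <= a n)%E -> a 0%N = 0%E ->
  (forall n, (0 < n)%N -> a n <= (C / n%:R ^+ 2)%:E)%E ->
  (\sum_(0 <= n <oo) a n < +oo)%E.
Proof.
move=> C0 a0 a00 aC; apply: (@le_lt_trans _ _ (2 * C)%:E); last by rewrite ltry.
apply: lime_le; first by apply: is_cvg_nneseries => *; exact: a0.
have H n : (\sum_(0 <= k < n.+1) a k <= (2 * C * (1 - n.+1%:R^-1))%:E)%E.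
  elim: n => [|n IH]; first by rewrite big_nat1 a00 invr1 subrr mulr0.
  rewrite big_nat_recr//=; apply: (le_trans (leeD IH (aC n.+1 _))) => //.
  rewrite -EFinD lee_fin.
  have n1 : (1 <= n.+1%:R :> R)%R by rewrite ler1n.
  have -> : (n.+2%:R = n.+1%:R + 1 :> R)%R by rewrite -natr1.
  move: (n.+1%:R) n1 => x x1; have x0 : (0 < x)%R by lra.
  have : (0 <= C * (x - 1) / (x ^+ 2 * (x + 1)))%R.
    by rewrite divr_ge0 ?mulr_ge0 ?subr_ge0 ?exprn_ge0 ?addr_ge0// ltW.
  have -> : (C * (x - 1) / (x ^+ 2 * (x + 1)) =
      2 * C * (1 - (x + 1)^-1) - (2 * C * (1 - x^-1) + C / x ^+ 2))%R.
    by field; rewrite !gt_eqF//; lra.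
  by rewrite subr_ge0.
near=> n.
have [->|n0] := posnP n; first by rewrite big_geq// lee_fin mulr_ge0.
rewrite -(prednK n0); apply: le_trans (H _) _.
by rewrite lee_fin ler_piMr ?mulr_ge0// gerBl invr_ge0.
Unshelve. all: by end_near.
Qed.

(** * Exceedance probabilities *)

(** [x0] is chosen so that the first term is exactly [n ^ -2]. In the logarithm of the second,
    [- n * u * beta] cancels [ln N] and the [(2 u / t) ln n] coming from [x0 ^ (- u)], and leaves
    [- 2 ln n]. The constant 3 is 2 from the L1 diameter over [n] steps plus 1 from the slack
    [1 / n] in the choice of [K]. *)
Lemma rate_bound (R : realType) (n N : nat) (u t s k v beta x0 : R) :
  (0 < n)%N -> (0 < N)%N -> 0 < u < 1 -> 0 < t -> 0 < k ->
  s + n%:R^-1 * ln k^-1 < v + n%:R^-1 ->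
  beta = v + n%:R^-1 * ln (N%:R `^ u^-1 * n%:R `^ (2 * (u^-1 + t^-1))) ->
  x0 = expR (- (n%:R * s) - 2 / t * ln n%:R) ->
  0 <= 1 - u * beta ->
  x0 `^ t * expR (t * s) ^+ n +
    N%:R * ((k * x0) `^ (- u) * (1 - u * beta + (2 * n%:R `^ (- u^-1)) `^ u) ^+ n)
  <= (1 + expR 3) / n%:R ^+ 2.
Proof.
move=> n0 N0 /andP[u0 u1] t0 k0 sv betaE x0E ub.
have nR : 0 < n%:R :> R by rewrite ltr0n.
have NR : 0 < N%:R :> R by rewrite ltr0n.
have powE (a r : R) : 0 < a -> a `^ r = expR (r * ln a) by move=> a0; rewrite /powR gt_eqF.
have nE : (n%:R ^+ 2)^-1 = expR (- (2 * ln n%:R)) :> R.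
  by rewrite expRN -powE// powR_mulrn// ltW.
have -> : (1 + expR 3) / n%:R ^+ 2 =
    expR (- (2 * ln n%:R)) + expR 3 * expR (- (2 * ln n%:R)) :> R.
  by rewrite -nE; ring.
apply: lerD.
  rewrite x0E -expRM -expRM_natl -expRD ler_expR le_eqVlt; apply/orP; left; apply/eqP.
  by field; rewrite gt_eqF.
(* The radius exponent [- 1 / u] makes the [u]-th power of the diameter of order [1 / n], so that
   [n] steps cost a bounded factor. *)
have Su : (2 * n%:R `^ (- u^-1)) `^ u <= 2 / n%:R :> R.
  have -> : (2 * n%:R `^ (- u^-1)) `^ u = 2 `^ u * n%:R^-1 :> R.
    rewrite powRM ?powR_ge0 ?ler0n// -powRrM mulNr mulVf ?(gt_eqF u0)//.
    by rewrite powR_inv1 ?ler0n.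
  rewrite ler_pM2r ?invr_gt0// -[leRHS]powRr1 ?ler0n//.
  by rewrite ler_powR ?(ltW u1)// ler1n.
have S0 : 0 <= (2 * n%:R `^ (- u^-1)) `^ u :> R by exact: powR_ge0.
apply: (@le_trans _ _ (N%:R * ((k * x0) `^ (- u) * expR (- (u * beta) + 2 / n%:R) ^+ n))).
  rewrite ler_pM2l// ler_wpM2l ?powR_ge0// lerXn2r ?nnegrE ?expR_ge0 ?(addr_ge0 ub S0)//.
  by apply: le_trans (expR_ge1Dx _); lra.
have kx0 : k * x0 = expR (ln k - n%:R * s - 2 / t * ln n%:R).
  by rewrite x0E -{1}(lnK (x := k)) ?posrE// -expRD addrA.
rewrite kx0 -expRM -expRM_natl -{1}(lnK (x := N%:R)) ?posrE// -!expRD ler_expR.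
rewrite betaE lnM ?posrE ?powR_gt0// !ln_powR.
move: sv; rewrite lnV ?posrE// => sv.
have {}sv : n%:R * s - ln k - n%:R * v < 1.
  have : n%:R * (s + n%:R^-1 * - ln k) < n%:R * (v + n%:R^-1) by rewrite ltr_pM2l.
  by rewrite !mulrDr mulrA divff ?gt_eqF// mul1r; lra.
have : u * (n%:R * s - ln k - n%:R * v) <= 1.
  apply: le_trans (_ : u * 1 <= 1); last by rewrite mulr1 ltW.
  by rewrite ler_pM2l// ltW.
set a := ln N%:R; set b := ln n%:R => H.
have -> : n%:R * (- (u * (v + n%:R^-1 * (u^-1 * a + 2 * (u^-1 + t^-1) * b))) + 2 / n%:R)
  = - (u * n%:R * v) - a - 2 * b - 2 * u / t * b + 2 :> R.
  by field; rewrite ?gt_eqF.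
have -> : (ln k - n%:R * s - 2 / t * b) * - u = - u * ln k + u * n%:R * s + 2 * u / t * b.
  by field; rewrite gt_eqF.
lra.
Qed.

Section exceedance.
Local Open Scope ereal_scope.
Context (R : realType) d (Y : measurableType d) (mu : {measure set Y -> \bar R}).
Variables (p0 : Y -> R) (hp0 : is_density mu p0).
Variables (G : set (set (Y -> R))).
Local Notation X := (g_sigma_algebraType G).
Variables (P : set X) (hP : forall f : X, P f -> is_density mu f).
Hypothesis mP : measurable P.
Hypothesis mev : measurable_fun (P `*` (setT : set Y))
  (fun z : X * Y => (z.1 : Y -> R) z.2).
Variable pi : probability X R.

(* Evaluation is measurable on P x Y only; outside P it is replaced by 0. *)
Definition clip (f : X) (y : Y) : R :=
  ((fun z : X * Y => (z.1 : Y -> R) z.2) \_ (P `*` setT)) (f, y).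

Lemma clipE f y : P f -> clip f y = f y.
Proof. by move=> Pf; rewrite /clip patchE mem_set. Qed.

Lemma clip_ge0 f y : (0 <= clip f y)%R.
Proof.
rewrite /clip patchE; case: ifPn => // /set_mem [/= Pf _].
by have [] := hP Pf.
Qed.

Lemma measurable_clip : measurable_fun setT (fun z : X * Y => clip z.1 z.2).
Proof.
have mPT : measurable (P `*` [set: Y]) by exact: measurableX.
rewrite (_ : (fun z => _) = (fun z : X * Y => (z.1 : Y -> R) z.2) \_ (P `*` setT)).
  by have /(measurable_restrictT _ mPT) := mev.
by apply/funext => -[].
Qed.

Lemma marginalE n (A : set X) (ys : n.-tuple Y) : A `<=` P ->
  marginal pi A ys = mass pi clip A ys.
Proof.
move=> AP; rewrite /marginal integral_mkcond; apply: eq_integral => f _.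
rewrite patchE indicE; have [/set_mem/AP Pf|] := boolP (f \in A); last by rewrite mul0e.
rewrite mul1e; congr EFin; apply: eq_bigr => i _.
by rewrite clipE.
Qed.

Let nu := mu_support hp0.
Let T r f := \int[nu]_y tilt r (p0 y) (clip f y).

Let T_ge0 r f : 0 <= T r f.
Proof.
by apply: integral_ge0 => y _; apply: tilt_ge0; have [] := hp0.
Qed.

Let measurable_T r : measurable_fun setT (T r).
Proof.
have [mp pos _] := hp0.
apply: (measurable_fun_fubini_tonelli_F (fun z : X * Y => tilt r (p0 z.2) (clip z.1 z.2))).
  apply: measurable_tilt => //; first exact: (measurableT_comp mp).
  exact: measurable_clip.
- by move=> z; exact: clip_ge0.
by move=> z; exact: tilt_ge0.
Qed.

Let divergence_T r f : P f -> divergence mu r p0 f = r^-1%:E * (T r f - 1).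
Proof.
move=> Pf; have [mf f0 _] := hP Pf; rewrite divergenceE//; congr (_ * (_ - _)).
rewrite -(integral_mu_support hp0); last by move=> y ->; rewrite tiltE eqxx.
by apply: eq_integral => y _; rewrite clipE.
Qed.

(** Tilt integrals are nonnegative, so each divergence is at least [- 1 / t], and [ln (1 / pi K)] is
    nonnegative. This excludes the value [-oo], so that the infimum, once known to be below [+oo],
    can be approached by sets [K]. *)
Lemma prior_divergence_ge n (t : R) : (0 < t)%R ->
  (- t^-1)%:E <= prior_divergence mu pi P t p0 n.
Proof.
move=> t0; apply/ereal_infP => _ [K [mK KP] <-].
case: eqP => [_|/eqP K0]; first by rewrite leey.
have [q Kq] : K !=set0 by apply/set0P; apply: contra_neq K0 => ->; rewrite measure0.
rewrite -[leLHS]adde0; apply: leeD.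
  apply: (@le_trans _ _ (divergence mu t p0 q)); last by apply: ereal_sup_ubound; exists q.
  rewrite divergence_T; last exact: KP.
  have := T_ge0 t q; case: (T t q) => [r| |]//; last by rewrite gt0_muley ?leey// lte_fin invr_gt0.
  rewrite lee_fin => r0; rewrite -EFinB -EFinM lee_fin mulrBr mulr1.
  by rewrite lerDr mulr_ge0// invr_ge0 ltW.
rewrite mule_ge0 ?lee_fin// lne_ge0 inve_ge1//.
exact: probability_le1.
Qed.

Variables (u t : R) (u01 : (0 < u < 1)%R) (t0 : (0 < t)%R).
Variables (n N : nat) (n0 : (0 < n)%N).
Hypothesis hN : L1_covered mu P N (n%:R `^ (- u^-1)).

Let bound := prior_divergence mu pi P t p0 n
     + (n%:R^-1 * ln (N%:R `^ u^-1 * n%:R `^ (2 * (u^-1 + t^-1))))%:E.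

Definition exceedance : set X := P `&` [set f | bound < divergence mu (- u) p0 f].

(** On [P] the divergence is an affine function of [T (- u)], which is measurable in [f] by
    Tonelli. *)
Lemma measurable_exceedance : measurable exceedance.
Proof.
rewrite (_ : exceedance = P `&` [set f | bound < (- u)^-1%:E * (T (- u) f - 1)]).
  apply: emeasurable_fun_o_infty => //; apply: measurable_funTS.
  by apply: measurable_funeM; apply: emeasurable_funB => //; exact: measurable_cst.
by rewrite /exceedance; apply/seteqP; split => f /= [Pf Bf]; split=> //;
  move: Bf; rewrite divergence_T.
Qed.

Lemma iid_posterior_exceedance_le : pi P = 1 ->
  iid_integral mu p0 (fun y : n.-tuple Y => posterior pi P exceedance y) <=
  ((1 + expR 3) / n%:R ^+ 2)%:E.
Proof.
move=> piP; have [mp pos _] := hp0; have /andP[u0 u1] := u01.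
have EP : exceedance `<=` P by move=> f [].
rewrite -(nfold_integral_mu_support hp0).
rewrite (_ : (fun ys => _) = (fun ys : n.-tuple Y => mass pi clip exceedance ys /
    mass pi clip P ys * (likelihood p0 ys)%:E)); last first.
  by apply/funext => ys; rewrite /posterior !marginalE.
(* A member [x1] of the exceedance set forces [0 < N], a finite bound and [0 <= 1 - u * beta]; if
   there is none, the posterior mass is 0. *)
have [[x1 [Px1 Bx1]]|E0] := pselect (exists x, exceedance x); last first.
  rewrite (_ : (fun ys => _) = (fun=> 0)) ?nfold_integral0.
    by rewrite lee_fin divr_ge0 ?exprn_ge0// addr_ge0// expR_ge0.
  apply/funext => ys; rewrite /mass integral0_eq ?mul0e// => x _.
  by rewrite indicE memNset ?mul0e// => Ex; apply: E0; exists x.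
have N0 : (0 < N)%N.
  by case: hN => c [_ /(_ _ Px1) [[k kN] _ _]]; exact: leq_ltn_trans kN.
have Bx1' : bound < (- u)^-1%:E * (T (- u) x1 - 1) by rewrite -divergence_T.
move: Bx1'; rewrite /bound; have := prior_divergence_ge n t0.
case E : (prior_divergence mu pi P t p0 n) => [v| |]// _; last first.
  by rewrite addye// => /lt_le_trans /(_ (leey _)); rewrite ltxx.
have vfin : prior_divergence mu pi P t p0 n \is a fin_num by rewrite E.
have n0' : (0 < n%:R^-1 :> R)%R by rewrite invr_gt0 ltr0n.
(* [K] is within [1 / n] of the infimum; its value is then finite, which rules out [pi K = 0]. *)
have [_ [K [mK KP] <-]] := lb_ereal_inf_adherent n0' vfin.
rewrite -/(prior_divergence mu pi P t p0 n) E.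
case: eqP => [_|/eqP K0]; first by rewrite ltNge leey.
set S := ereal_sup _.
have piK0 : 0 < pi K by rewrite lt_neqAle eq_sym K0 measure_ge0.
have piKfin : pi K \is a fin_num by exact: fin_num_measure.
have k0 : (0 < fine (pi K))%R by rewrite fine_gt0// piK0 -ge0_fin_numE.
rewrite -[in lne _](fineK piKfin) inver gt_eqF// lne_EFin ?invr_gt0// => Slt.
have [q Kq] : K !=set0 by apply/set0P; apply: contra_neq K0 => ->; rewrite measure0.
have Sub f : K f -> divergence mu t p0 f <= S by move=> Kf; apply: ereal_sup_ubound; exists f.
have [s Ss] : exists s, S = s%:E.
  have : -oo < S.
    apply: lt_le_trans (Sub _ Kq); rewrite divergence_T; last exact: KP.
    have := T_ge0 t q; case: (T t q) => [r| |]// _; first by rewrite -EFinB -EFinM ltNyr.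
    by rewrite gt0_muley ?lte_fin ?invr_gt0.
  by move: Slt; case: (S) => [s| |]//; exists s.
rewrite Ss -EFinM -!EFinD lte_fin in Slt.
pose beta : R := (v + n%:R^-1 * ln (N%:R `^ u^-1 * n%:R `^ (2 * (u^-1 + t^-1))))%R.
have betaE : bound = beta%:E by rewrite /bound E.
move=> _.
have [c [dc Pc]] := hN.
pose r : R := (n%:R `^ (- u^-1))%R.
pose B (j : 'I_N) := exceedance `&` [set f | \int[nu]_y (`|clip f y - c j y|)%:E <= r%:E].
(* Multiplying by [- u] reverses the inequality: a divergence above [beta] means an affinity below
   [1 - u * beta]. *)
have T_exceedance f : exceedance f -> T (- u) f <= (1 - u * beta)%:E.
  move=> [Pf]; rewrite /= betaE divergence_T//.
  have := T_ge0 (- u) f; case: (T (- u) f) => [T'| |]// _.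
    rewrite -EFinB -EFinM lte_fin lee_fin invrN mulNr ltrNr => H.
    have : (u * (u^-1 * (T' - 1)) < u * - beta)%R by rewrite ltr_pM2l.
    rewrite mulrA divff ?gt_eqF// mul1r mulrN; lra.
  by rewrite lt0_muley// lte_fin invr_lt0 oppr_lt0.
have ub : (0 <= 1 - u * beta)%R.
  by rewrite -lee_fin; apply: le_trans (T_ge0 (- u) x1) (T_exceedance _ _); split.
have mB j : measurable (B j).
  have [mc _ _] := dc j.
  have mL : measurable_fun setT (fun f => \int[nu]_y (`|clip f y - c j y|)%:E).
    apply: (measurable_fun_fubini_tonelli_F (m2 := nu)
      (fun z : X * Y => (`|clip z.1 z.2 - c j z.2|)%:E)); last by move=> z; rewrite lee_fin.
    apply/measurable_EFinP; apply: measurableT_comp => //.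
    by apply: measurable_funB; [exact: measurable_clip|exact: (measurableT_comp mc)].
  rewrite /B -[X in _ `&` X]setTI; apply: measurableI; first exact: measurable_exceedance.
  exact: emeasurable_fun_infty_c.
have mclip f : measurable_fun setT (clip f) by exact: (measurable_fun_pair2 f measurable_clip).
have mdiff (f g : Y -> R) : measurable_fun setT f -> measurable_fun setT g ->
    measurable_fun setT (fun y => (`|f y - g y|)%:E).
  by move=> mf mg; apply/measurable_EFinP; apply: measurableT_comp => //; exact: measurable_funB.
have EB : exceedance `<=` \bigcup_j B j.
  move=> f Ef; have [j _ [df fcr]] := Pc _ (EP _ Ef); have [mf _ _] := df; have [mc _ _] := dc j.
  exists j => //; split => //=; apply: le_trans fcr.
  apply: le_trans (le_integral_mu_support hp0 (mdiff _ _ mf mc) _); last by move=> y; rewrite lee_fin.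
  by apply: ge0_le_integralT => y; rewrite ?lee_fin// clipE//; exact: EP.
pose x0 : R := (expR (- (n%:R * s) - 2 / t * ln n%:R))%R.
(* [rho1 = expR (t * s)] comes from [1 + t * s <= expR (t * s)] on [K]; [2 * r] is the L1 diameter
   of a ball, by the triangle inequality through its centre [c j]. *)
have step := @nfold_posterior_le _ X _ Y R pi nu clip p0 measurable_clip clip_ge0
  (density_mu_support hp0) n N exceedance K P B t u x0 (expR (t * s)) (1 - u * beta)%R (2 * r)%R
  mK mB EP KP EB t0 u01 (expR_gt0 _) piK0 (expR_ge0 _) ub.
have kn := @rate_bound R n N u t s (fine (pi K)) v beta x0 n0 N0 u01 t0 k0 Slt erefl erefl ub.
apply: le_trans (step _ _ _ _) _; last by rewrite lee_fin.
- by rewrite mulr_ge0// powR_ge0.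
- move=> f Kf; have := Sub _ Kf; rewrite Ss divergence_T; last exact: KP.
  rewrite -/(T t f); have := T_ge0 t f; case: (T t f) => [T'| |]// _; last first.
    by rewrite gt0_muley ?lte_fin ?invr_gt0.
  rewrite -EFinB -EFinM !lee_fin => H; apply: le_trans (expR_ge1Dx _).
  have : (t * (t^-1 * (T' - 1)) <= t * s)%R by rewrite ler_pM2l.
  rewrite mulrA divff ?gt_eqF// mul1r; lra.
- by move=> j f [Ef _]; exact: T_exceedance.
- move=> j f g [_ fB] [_ gB]; have [mc _ _] := dc j.
  apply: (@le_trans _ _ (\int[nu]_y ((`|clip f y - c j y|)%:E + (`|clip g y - c j y|)%:E))).
    apply: ge0_le_integralT => y; first by rewrite lee_fin.
    rewrite -EFinD lee_fin.
    have -> : (clip f y - clip g y = (clip f y - c j y) - (clip g y - c j y))%R by ring.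
    exact: ler_normB.
  rewrite ge0_integralD//; try exact: mdiff.
  by rewrite mulr2n mulrDl !mul1r EFinD; exact: leeD.
Qed.

End exceedance.

(** * The almost sure bound by Borel-Cantelli *)

Theorem proposition3
  (R : realType) (d : measure_display) (Y : measurableType d)
  (mu : {measure set Y -> \bar R})
  (p0 : Y -> R) (hp0 : is_density mu p0)
  (P : set (Y -> R)) (hP : forall f, P f -> is_density mu f)
  (G : set (set (Y -> R)))
  (mP : measurable (P : set (g_sigma_algebraType G)))
  (mev : measurable_fun
           ((P : set (g_sigma_algebraType G)) `*` (setT : set Y))
           (fun z : g_sigma_algebraType G * Y => (z.1 : Y -> R) z.2))
  (pi : probability (g_sigma_algebraType G) R)
  (hpi : pi (P : set (g_sigma_algebraType G)) = 1%E)
  (dO : measure_display) (Omega : measurableType dO)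
  (Pr : probability Omega R)
  (p : nat -> {RV Pr >-> g_sigma_algebraType G})
  (hp : posterior_sequence mu pi P p0 p)
  (u : R) (hu : exists2 k : nat, (2 <= k)%N & u = k%:R^-1)
  (t : R) (ht : 0 < t)
  (N : nat -> nat)
  (hN : forall n : nat, (0 < n)%N -> L1_covered mu P (N n) (n%:R `^ (- u^-1))) :
  {ae Pr, forall w, \forall n \near \oo,
    (divergence mu (- u) p0 (p n w) <=
     prior_divergence mu pi P t p0 n
     + (n%:R^-1 * ln ((N n)%:R `^ u^-1
                      * n%:R `^ (2 * (u^-1 + t^-1))))%:E)%E}.
Proof.
have u01 : 0 < u < 1.
  have [k k2 ->] := hu; have k0 : (0 < k)%N by exact: leq_trans k2.
  by rewrite invr_gt0 ltr0n k0/= invf_lt1 ?ltr0n// ltr1n.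
pose bad n := exceedance mu p0 P pi u t n (N n).
(* The posterior sequence is unconstrained at sample size 0, so that event is replaced by the empty
   set. *)
pose E n : set Omega := if n is 0 then set0 else p n @^-1` bad n.
have mbad n : measurable (bad n) by exact: measurable_exceedance.
have mE n : measurable (E n).
  case: n => [|n]; first exact: measurable0.
  by rewrite -[E _]setTI; exact: measurable_funP.
have PrE n : (0 < n)%N -> (Pr (E n) <= ((1 + expR 3) / n%:R ^+ 2)%:E)%E.
  case: n => [//|n] n0; have badP : bad n.+1 `<=` P by move=> f [].
  have [_ _ /(_ _ (mbad n.+1) badP) e] := hp _ n0; rewrite [E _]/= e.
  exact: (iid_posterior_exceedance_le hp0 hP mP mev u01 ht n0 (hN _ n0) hpi).
(* The convergence half of Borel-Cantelli: summability of the probabilities suffices, whatever the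
   joint law across sample sizes. *)
have limE : Pr (lim_sup_set E) = 0%E.
  apply: lim_sup_set_cvg0 => //.
  have C0 : 0 <= 1 + expR 3 :> R by rewrite addr_ge0 ?expR_ge0.
  by apply: (nneseries_inv_sqr_lty C0) => //; rewrite /E measure0.
exists (lim_sup_set E); split=> //.
  apply: bigcap_measurable => [|k _]; first by exists 0%N.
  by apply: bigcup_measurable => j _.
move=> w nw k _; apply: contrapT => nE; apply: nw.
(* Outside every [E n] with [n >= k] the bound holds from [k] on, except possibly at 0, where [E] is
   empty; hence the threshold is at least 1. *)
exists (maxn k 1) => // n /= kn.
have n0 : (0 < n)%N by rewrite (leq_trans _ kn)// leq_max orbT.
have [pP _ _] := hp _ n0.
rewrite leNgt; apply/negP => bound_lt; apply: nE.
exists n; first by rewrite /= (leq_trans _ kn)// leq_maxl.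
by case: n n0 {kn} pP bound_lt => [//|n] _ pP bound_lt; split; [exact: pP|].
Qed.
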